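(* Let $\mathcal{L} \subset \mathbb{S}^n$ be a regular linear subspace of codimension at least two, and let $S \in \mathbb{P}\mathbb{S}^n$ be generic. Let $\mathcal{G}_S := \{\ell \in \mathrm{Gr}(1,\mathbb{P}\mathbb{S}^n) \mid S \in \ell\}$ and $$\mathcal{J} := \overline{\{\ell \in \mathrm{Gr}(1,\mathbb{P}\mathbb{S}^n) \mid \exists (\Sigma,\Gamma) \in L^{-1}\times L^\perp : \Sigma \neq \Gamma,\ \Sigma \in \ell,\ \Gamma \in \ell\}}.$$ Then the ML degree of $\mathcal{L}$ equals $|\mathcal{J} \cap \mathcal{G}_S|$.
   Context: $\mathbb{S}^n$ denotes the space of complex symmetric $n\times n$ matrices, with the bilinear pairing $\langle K,\Sigma\rangle = \mathrm{tr}(K\Sigma)$, and $\mathbb{P}\mathbb{S}^n$ its projectivization. A linear subspace $\mathcal{L}\subseteq\mathbb{S}^n$ is regular if it contains a matrix of full rank. Its polar space is $\mathcal{L}^\perp = \{\Sigma \in \mathbb{S}^n : \mathrm{tr}(K\Sigma)=0 \ \forall K\in\mathcal{L}\}$. The reciprocal variety $\mathcal{L}^{-1}$ is the Zariski closure in $\mathbb{S}^n$ of the set of inverses of the invertible matrices in $\mathcal{L}$. The maximum likelihood (ML) degree of $\mathcal{L}$ is the number of matrices in $\mathcal{L}^{-1}\cap(\mathcal{L}^\perp + S)$ for generic $S\in\mathbb{S}^n$. $L^{-1}$ and $L^\perp$ denote the projectivizations of $\mathcal{L}^{-1}$ and $\mathcal{L}^\perp$ in $\mathbb{P}\mathbb{S}^n$.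 $\mathrm{Gr}(1,\mathbb{P}\mathbb{S}^n)$ is the Grassmannian of lines in $\mathbb{P}\mathbb{S}^n$. *)

(* Defs.v *)
From HB Require Import structures.
From mathcomp Require Import all_boot all_algebra all_field.
From mathcomp Require Import mpoly.
From mathcomp Require Import complex Rstruct.
Set Implicit Arguments. Unset Strict Implicit. Unset Printing Implicit Defensive.
Import GRing.Theory.
Local Open Scope ring_scope.

Definition CC : closedFieldType := (Rdefinitions.R)[i].

Definition symm n (A : 'M[CC]_n) : Prop := A^T = A.

Definition mxeval n (p : {mpoly CC[n * n]}) (A : 'M[CC]_n) : CC :=
  p.@[fun i => mxvec A 0 i].

(* Zariski closure (in M_n, equivalently in S^n since S^n is closed)
   of a set of matrices. *)
Definition zclosure n (P : 'M[CC]_n -> Prop) (X : 'M[CC]_n) : Prop :=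
  forall p : {mpoly CC[n * n]},
    (forall Y, P Y -> mxeval p Y = 0) -> mxeval p X = 0.

Definition polar n (L : {vspace 'M[CC]_n}) (G : 'M[CC]_n) : Prop :=
  symm G /\ forall K, K \in L -> \tr (K *m G) = 0.

Definition recip n (L : {vspace 'M[CC]_n}) : 'M[CC]_n -> Prop :=
  zclosure (fun Y => exists2 K, K \in L & K \in unitmx /\ Y = invmx K).

Definition has_card (T : eqType) (P : T -> Prop) (d : nat) : Prop :=
  exists s : seq T, [/\ uniq s, size s = d & forall x, P x <-> x \in s].

(* A property holds for generic S in S^n: it holds on a nonempty Zariski
   open subset of S^n, i.e. outside the zero set of a polynomial that does
   not vanish identically on S^n. *)
Definition generic n (P : 'M[CC]_n -> Prop) : Prop :=
  exists f : {mpoly CC[n * n]},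
    (exists2 S0, symm S0 & mxeval f S0 != 0) /\
    (forall S, symm S -> mxeval f S != 0 -> P S).

Definition ML_degree n (L : {vspace 'M[CC]_n}) (d : nat) : Prop :=
  generic (fun S => has_card (fun X => recip L X /\ polar L (X - S)) d).

(* Lines of P S^n: 2-dimensional linear subspaces of S^n.  A projective
   point [A] (A <> 0) lies on the line W iff A \in W. *)
Definition is_line n (W : {vspace 'M[CC]_n}) : Prop :=
  \dim W = 2%N /\ forall A, A \in W -> symm A.

(* Plücker coordinates of the line spanned by u, v: the coordinates of
   u /\ v in /\^2 M_n  (entries u_a v_b - u_b v_a of the vectorizations). *)
Definition plucker n (u v : 'M[CC]_n) : 'rV[CC]_(n * n * (n * n)) :=
  mxvec ((mxvec u)^T *m mxvec v - (mxvec v)^T *m mxvec u).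

Definition pl_eval n (p : {mpoly CC[n * n * (n * n)]}) (u v : 'M[CC]_n) : CC :=
  p.@[fun i => plucker u v 0 i].

(* Zariski closure, inside the Grassmannian Gr(1, P S^n) (embedded by
   Plücker coordinates), of a set J of lines. *)
Definition gr_closure n (J : {vspace 'M[CC]_n} -> Prop)
    (W : {vspace 'M[CC]_n}) : Prop :=
  is_line W /\
  forall p : {mpoly CC[n * n * (n * n)]},
    (forall u v, free [:: u; v] -> J (<[u]> + <[v]>)%VS -> pl_eval p u v = 0) ->
    (forall u v, free [:: u; v] -> (<[u]> + <[v]>)%VS = W -> pl_eval p u v = 0).

Definition J0 n (L : {vspace 'M[CC]_n}) (W : {vspace 'M[CC]_n}) : Prop :=
  is_line W /\
  exists Sg Gm : 'M[CC]_n,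
    [/\ recip L Sg, polar L Gm, free [:: Sg; Gm], Sg \in W & Gm \in W].

Definition Jvar n (L : {vspace 'M[CC]_n}) := gr_closure (J0 L).

Definition lines_through n (S : 'M[CC]_n) (W : {vspace 'M[CC]_n}) : Prop :=
  is_line W /\ S \in W.

(* Main.v *)
Require Import Defs.
From HB Require Import structures.
From mathcomp Require Import all_boot all_algebra all_field.
From mathcomp Require Import mpoly.
From mathcomp Require Import complex Rstruct.
From mathcomp Require Import ring.
From Stdlib Require Import Classical.
Set Implicit Arguments. Unset Strict Implicit. Unset Printing Implicit Defensive.
Import GRing.Theory.
Local Open Scope ring_scope.

(* Let pi be the projection of S^n along the polar space, given by the pairings with a
   basis of L; the matrices counted by the ML degree form the fiber of pi, restricted
   to the reciprocal variety X, over pi(S). Counting monomials shows that every matrix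
   entry T on X satisfies a relation P_ab(T, pi) = 0, so generic fibers are finite, of
   bounded size, and consist of invertible matrices. Hence "the fiber has at least k
   points" is first-order definable over affine space, and by quantifier elimination
   holds or fails generically; this gives the generic cardinality d.

   For generic S the map sending a point Y of the fiber to the line SY is injective,
   because the codimension is at least two and so S avoids the finitely many secants
   of the fiber, which lie in the affine space S + polar. Its image is contained in J.
   Conversely a line of J through S meets the polar space in some G, and where the
   leading coefficients of the P_ab do not vanish pi is finite on X, so that elimination
   of t shows that some S + t G lies in X. *)

(** The reciprocal variety is a closure, so its points are known only through the polynomials that
    vanish on inverses: each fact about them is an identity checked at the inverses of [lincomb L x]
    and then extended. Membership in the closure is not visibly first-order. This is why fiber
    points must be invertible: they are then given by the coordinates of their inverses in [L], and
    conditions on them become formulas in those coordinates.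

    In codimension one the whole fiber would lie on a single line through [S], in the direction of
    the polar space, and all its points would give the same line of J. A two-dimensional polar space
    leaves room to move [S] off the secants without changing the fiber.

    A line of J is only a limit of lines meeting both varieties, and nothing says at first that it
    meets either. Meeting the polar space is a polynomial condition on Pluecker coordinates and
    passes to the limit directly. Meeting the reciprocal variety has to be expressed by a resultant,
    which detects a common root only while one of the two polynomials keeps its degree; the leading
    coefficients of the [P a b] provide that. *)

(** * Algebraic dependence by counting monomials *)

Section AlgebraicDependence.
Variables (F : fieldType) (m : nat).
Implicit Types (p q h : {mpoly F[m]}).

Lemma msizeM_leS p q a b :
  (msize p <= a.+1 -> msize q <= b.+1 -> msize (p * q) <= (a + b).+1)%N.
Proof.
move=> pa qb.
have [->|p0] := eqVneq p 0; first by rewrite mul0r msize0.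
have [->|q0] := eqVneq q 0; first by rewrite mulr0 msize0.
rewrite msizeM //; apply: (@leq_trans (a.+1 + b.+1).-1); last by rewrite addnS.
by rewrite -!subn1 leq_sub2r ?leq_add.
Qed.

Lemma msizeX_leS p a k : (msize p <= a.+1 -> msize (p ^+ k) <= (a * k).+1)%N.
Proof.
move=> pa; elim: k => [|k IH]; first by rewrite expr0 muln0 msize1.
by rewrite exprS mulnS msizeM_leS.
Qed.

Lemma msize_prod_leS k (P : 'I_k -> {mpoly F[m]}) (a : 'I_k -> nat) :
  (forall i, msize (P i) <= (a i).+1)%N ->
  (msize (\prod_i P i) <= (\sum_i a i).+1)%N.
Proof.
move=> Pa; elim/big_rec2: _ => [|i x y _ IH]; first by rewrite msize1.
exact: msizeM_leS.
Qed.

Definition mnm_of_ffun D (e : {ffun 'I_m -> 'I_D}) : 'X_{1..m} :=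
  [multinom (e k : nat) | k < m].

Lemma mnm_of_ffun_inj D : injective (@mnm_of_ffun D).
Proof.
move=> e e' /mnmP E; apply/ffunP => k; apply: val_inj.
by have := E k; rewrite !mnmE.
Qed.

(** Monomials of total degree less than [D] are among the [D ^ m] given by exponent functions, so
    the coefficient matrix has more rows than columns and a nonzero left kernel. *)
Lemma linear_dependence (I : finType) D (q : I -> {mpoly F[m]}) :
  (forall i, msize (q i) <= D)%N -> (D ^ m < #|I|)%N ->
  exists c : I -> F, (exists i, c i != 0) /\ \sum_i c i *: q i = 0.
Proof.
move=> szq ltDI.
pose J := {ffun 'I_m -> 'I_D}.
pose A : 'M[F]_(#|I|, #|{: J}|) :=
  \matrix_(i, j) (q (enum_val i))@_(mnm_of_ffun (enum_val j)).
have: kermx A != 0.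
  rewrite kermx_eq0 /row_free; apply/eqP => rA.
  have := rank_leq_col A; rewrite rA card_ffun !card_ord leqNgt.
  by rewrite ltDI.
case/rowV0Pn => v /sub_kermxP vA v0.
exists (fun i => v 0 (enum_rank i)); split.
  apply: NNPP => nex; case/eqP: v0; apply/rowP => j; rewrite mxE.
  by apply: NNPP => /eqP vj; case: nex; exists (enum_val j); rewrite enum_valK.
apply/mpolyP => mm; rewrite mcoeff0 raddf_sum /=.
case: (leqP D (mdeg mm)) => [leD|ltD].
  apply: big1 => i _; rewrite mcoeffZ.
  suff ->: (q i)@_mm = 0 by rewrite mulr0.
  by apply/eqP; rewrite mcoeff_eq0 msize_mdeg_ge // (leq_trans _ leD).
have ltmm k : (mm k < D)%N.
  by apply: leq_ltn_trans ltD; rewrite mdegE (bigD1 k) //= leq_addr.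
pose e : J := [ffun k => Ordinal (ltmm k)].
have -> : mm = mnm_of_ffun e by apply/mnmP => k; rewrite mnmE ffunE.
have := congr1 (fun B : 'rV_#|{: J}| => B 0 (enum_rank e)) vA.
rewrite !mxE => {2}<-; rewrite (reindex (enum_val : 'I_#|I| -> I)) /=; last first.
  by apply: onW_bij; apply: enum_val_bij.
by apply: eq_bigr => i _; rewrite mcoeffZ !mxE !enum_rankK enum_valK.
Qed.

(* The number E is chosen so that the E^(m+1) monomials of partial degrees less
   than E in the m+1 functions outnumber the monomials in m variables which can
   occur in them once the denominators are cleared. *)
Lemma algebraic_dependence h (g0 : {mpoly F[m]}) (g : 'I_m -> {mpoly F[m]}) :
  exists2 P : {poly {mpoly F[m]}}, P != 0 &
    forall x, h.@[x] != 0 ->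
      (map_poly (meval (fun j => (g j).@[x] / h.@[x])) P).[g0.@[x] / h.@[x]] = 0.
Proof.
have [d [hd g0d gd]] : exists d, [/\ (msize h <= d.+1)%N, (msize g0 <= d.+1)%N &
    forall j, (msize (g j) <= d.+1)%N].
  exists (msize h + msize g0 + \sum_j msize (g j))%N; split.
  - by rewrite leqW // -addnA leq_addr.
  - by rewrite leqW // -addnA addnCA leq_addr.
  by move=> j; rewrite leqW // (bigD1 j) //= addnCA leq_addr.
(* Here d M + 1 is at most (d (m+1) + 1) E, whose m-th power is E0 E^m, which is less than
   E^(m+1). *)
pose E0 := ((d * m.+1).+1 ^ m)%N; pose E := E0.+1; pose M := (m.+1 * E)%N.
pose I := ('I_E * {ffun 'I_m -> 'I_E})%type.
pose w (i : I) := (i.1 + \sum_j i.2 j)%N.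
have wM i : (w i <= M)%N.
  rewrite /w /M mulSn; apply: leq_add; first exact: ltnW.
  have -> : (m * E = \sum_(j < m) E)%N by rewrite sum_nat_const card_ord.
  by apply: leq_sum => j _; apply: ltnW.
(* This is [h ^+ M] times the monomial with exponents [i] in the fractions [g0 / h] and [g j / h]; a
   linear relation among the [q i] thus becomes a relation among the fractions. *)
pose q (i : I) := g0 ^+ i.1 * (\prod_j g j ^+ i.2 j) * h ^+ (M - w i).
have szq i : (msize (q i) <= (d * M).+1)%N.
  rewrite -(subnKC (wM i)) mulnDr; apply: msizeM_leS; last exact: msizeX_leS.
  rewrite /w mulnDr; apply: msizeM_leS; first exact: msizeX_leS.
  rewrite big_distrr; apply: msize_prod_leS => j; exact: msizeX_leS.
have ltI : ((d * M).+1 ^ m < #|{: I}|)%N.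
  rewrite card_prod card_ffun !card_ord.
  apply: (@leq_ltn_trans (((d * m.+1).+1 * E) ^ m)).
    have leX a b k : (a <= b -> a ^ k <= b ^ k)%N.
      by case: k => // k ab; rewrite leq_exp2r.
    by apply: leX; rewrite mulSn /M mulnA -add1n leq_add.
  by rewrite expnMn ltn_pmul2r ?expn_gt0.
have [c [[i0 c0] cq]] := linear_dependence szq ltI.
exists (\poly_(k < E) \sum_e c (inord k, e) *: 'X_[mnm_of_ffun e]).
  apply/eqP => P0; move/eqP: c0; case.
  have := congr1 (fun P : {poly {mpoly F[m]}} => (P`_(i0.1))@_(mnm_of_ffun i0.2)) P0.
  rewrite coef_poly ltn_ord coef0 mcoeff0 inord_val raddf_sum /= (bigD1 i0.2) //=.
  rewrite big1 => [|e ne]; last first.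
    rewrite mcoeffZ mcoeffX; case: eqP => [/mnm_of_ffun_inj ee|]; last by rewrite mulr0.
    by rewrite ee eqxx in ne.
  by rewrite addr0 mcoeffZ mcoeffX eqxx mulr1 -surjective_pairing.
move=> x hx; set y := fun j => _; set t := _ / _.
have hM : h.@[x] ^+ M != 0 by rewrite expf_neq0.
apply: (mulfI hM); rewrite mulr0 -[RHS](meval0 x) -[X in _ = X.@[x]]cq.
rewrite (@horner_coef_wide _ E); last first.
  by apply: leq_trans (size_poly _ _) _; rewrite size_poly.
rewrite raddf_sum /= [RHS](eq_bigr (fun i : I => (c (i.1, i.2) *: q (i.1, i.2)).@[x]));
  last by case.
rewrite -(pair_bigA _ (fun a b => (c (a, b) *: q (a, b)).@[x])) /=.
rewrite big_distrr /=; apply: eq_bigr => k _.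
rewrite coef_map coef_poly ltn_ord inord_val raddf_sum /= big_distrl big_distrr /=.
apply: eq_bigr => e _.
rewrite !mevalZ mevalX /q !mevalM !rmorphXn rmorph_prod /=.
rewrite -{1}(subnKC (wM (k, e))) /w !exprD /= -prodrXr /t expr_div_n.
set hk := h.@[x] ^+ k; set hr := h.@[x] ^+ (M - _).
have hk0 : hk != 0 by rewrite expf_neq0.
have -> : \prod_i (y i) ^+ mnm_of_ffun e i =
   (\prod_i (g i).@[x] ^+ e i) / \prod_i h.@[x] ^+ e i.
  rewrite -prodf_div; apply: eq_bigr => i _; by rewrite mnmE expr_div_n.
have he0 : \prod_i h.@[x] ^+ e i != 0.
  by apply/prodf_neq0 => i _; rewrite expf_neq0.
have -> : \prod_i (g i ^+ e i).@[x] = \prod_i (g i).@[x] ^+ e i.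
  by apply: eq_bigr => i _; rewrite rmorphXn.
field; exact/andP.
Qed.

End AlgebraicDependence.

(** * Nonvanishing of polynomials and quantifier elimination over a closed field *)

Lemma rmorph_mmap k (R : nzRingType) (S S' : comNzRingType) (f : R -> S)
    (phi : {rmorphism S -> S'}) (h : 'I_k -> S) (p : {mpoly R[k]}) :
  phi (mmap f h p) = mmap (phi \o f) (phi \o h) p.
Proof.
rewrite /mmap rmorph_sum; apply: eq_bigr => mm _.
rewrite rmorphM /mmap1 rmorph_prod; congr (_ * _).
by apply: eq_bigr => i _; rewrite rmorphXn.
Qed.

Section ClosedField.
Variable F : closedFieldType.

Lemma horner_mmap k (p : {mpoly F[k]}) (h : 'I_k -> {poly F}) t :
  (mmap polyC h p).[t] = p.@[fun i => (h i).[t]].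
Proof.
have := rmorph_mmap polyC (horner_eval t) h p.
rewrite /= /horner_eval => ->; apply: eq_bigr => mm _.
by rewrite /= hornerC.
Qed.

Lemma meval_line k (p : {mpoly F[k]}) (u v : 'I_k -> F) :
  exists q : {poly F}, forall t, q.[t] = p.@[fun i => u i + t * v i].
Proof.
exists (mmap polyC (fun i => (u i)%:P + v i *: 'X) p) => t.
by rewrite horner_mmap; apply: meval_eq => i; rewrite !hornerE mulrC.
Qed.

(** Irreducibility of affine space: on the line from [u] to [v] both polynomials restrict to nonzero
    univariate ones. Keeping the new point on this line lets [generic_and] stay inside the symmetric
    matrices. *)
Lemma meval_neq0_mul k (p q : {mpoly F[k]}) u v :
  p.@[u] != 0 -> q.@[v] != 0 ->
  exists t, (p * q).@[fun i => u i + t * (v i - u i)] != 0.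
Proof.
move=> pu qv.
have [p' p'E] := meval_line p u (fun i => v i - u i).
have [q' q'E] := meval_line q u (fun i => v i - u i).
have p0 : p' != 0.
  apply: contraNneq pu => p0; have := p'E 0; rewrite p0 horner0 => ->.
  by apply/eqP/meval_eq => i; rewrite mul0r addr0.
have q0 : q' != 0.
  apply: contraNneq qv => q0; have := q'E 1; rewrite q0 horner0 => ->.
  by apply/eqP/meval_eq => i; rewrite mul1r addrC subrK.
have [t] := closed_nonrootP _ (mulf_neq0 p0 q0).
by rewrite rootE hornerM p'E q'E => pq; exists t; rewrite mevalM.
Qed.

Lemma meval_muni k (p : {mpoly F[k.+1]}) (w : 'I_k.+1 -> F) :
  p.@[w] = (map_poly (meval (w \o lift ord_max)) (muni p)).[w ord_max].
Proof.
have lm (i : 'I_k) : lift ord_max i = widen_ord (leqnSn k) i.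
  by apply: val_inj; rewrite /= /bump leqNgt ltn_ord.
rewrite muniE mevalE rmorph_sum /= horner_sum; apply: eq_bigr => mm _ /=.
rewrite -mul_polyC rmorphM /= map_polyC map_polyXn !hornerE /= mevalZ mevalX.
rewrite big_ord_recr /= mulrA; congr (_ * _ * _).
by apply: eq_bigr => i _; rewrite mnmE lm.
Qed.

Lemma muni_neq0 k (p : {mpoly F[k.+1]}) : p != 0 -> muni p != 0.
Proof.
move=> p0; pose r (mm : 'X_{1..k.+1}) := [multinom mm (widen_ord (leqnSn k) i) | i < k].
have rinj m1 m2 : r m1 = r m2 -> m1 ord_max = m2 ord_max -> m1 = m2.
  move=> rE mE; apply/mnmP => i; case: (unliftP ord_max i) => [j|] -> //.
  have -> : lift ord_max j = widen_ord (leqnSn k) j.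
    by apply: val_inj; rewrite /= /bump leqNgt ltn_ord.
  by have := congr1 (fun s : 'X_{1..k} => s j) rE; rewrite !mnmE.
have := mlead_supp p0; set m0 := mlead p => m0p.
apply: contraTneq (m0p) => mu0; rewrite -mcoeff_eq0; apply/eqP.
have := congr1 (fun P : {poly {mpoly F[k]}} => (P`_(m0 ord_max))@_(r m0)) mu0.
rewrite coef0 mcoeff0 muniE coef_sum raddf_sum /= (bigD1_seq m0) ?msupp_uniq //=.
rewrite big1 => [|mm nmm].
  by rewrite addr0 coefZ coefXn eqxx mulr1 mcoeffZ mcoeffX eqxx mulr1.
rewrite coefZ coefXn; case: eqP => [E|]; last by rewrite mulr0 mcoeff0.
rewrite mulr1 mcoeffZ mcoeffX; case: eqP => [E'|]; last by rewrite mulr0.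
by rewrite (rinj _ _ E' (esym E)) eqxx in nmm.
Qed.

(** By induction, the leading coefficient in the last variable is nonzero at some [v]; over that [v]
    there is a non-root for the last coordinate. *)
Lemma meval_neq0 k (p : {mpoly F[k]}) : p != 0 -> exists v, p.@[v] != 0.
Proof.
elim: k p => [|k IH] p p0.
  exists (fun=> 0); rewrite [p]nvar0_mpolyC mevalC.
  by apply: contraNneq p0; rewrite [p]nvar0_mpolyC mcoeffC eqxx mulr1 => ->; rewrite mpolyC0.
have := muni_neq0 p0; rewrite -lead_coef_eq0 => /IH [v pv].
have : map_poly (meval v) (muni p) != 0.
  apply: contraNneq pv => /(congr1 (fun P : {poly F} => P`_(size (muni p)).-1)).
  by rewrite coef_map coef0 => ->.
case/closed_nonrootP => t; rewrite rootE => pt.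
exists (fun i => oapp v t (unlift ord_max i)); rewrite meval_muni unlift_none /=.
rewrite (_ : map_poly _ _ = map_poly (meval v) (muni p)) //.
by apply: eq_map_poly => q; apply: meval_eq => i /=; rewrite liftK.
Qed.

Definition env k (v : 'I_k -> F) : seq F := [seq v i | i <- enum 'I_k].

Lemma nth_env k (v : 'I_k -> F) (i : 'I_k) : (env v)`_i = v i.
Proof. by rewrite (nth_map i) ?size_enum_ord // nth_ord_enum. Qed.

Lemma size_env k (v : 'I_k -> F) : size (env v) = k.
Proof. by rewrite size_map size_enum_ord. Qed.

Lemma rterm_mpoly k (t : GRing.term F) : GRing.rterm t ->
  exists p : {mpoly F[k]}, forall v, GRing.eval (env v) t = p.@[v].
Proof.
elim: t => //=.
- move=> i _; case: (ltnP i k) => ik.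
    by exists 'X_(Ordinal ik) => v; rewrite mevalXU -(nth_env v).
  (* A variable outside the environment evaluates to the default value 0. *)
  by exists 0 => v; rewrite meval0 nth_default // size_env.
- by move=> c _; exists c%:MP => v; rewrite mevalC.
- by move=> c _; exists (c%:R) => v; rewrite rmorph_nat.
- move=> t1 IH1 t2 IH2 /andP[/IH1[p1 E1] /IH2[p2 E2]].
  by exists (p1 + p2) => v; rewrite mevalD E1 E2.
- by move=> t1 IH1 /IH1[p1 E1]; exists (- p1) => v; rewrite mevalN E1.
- by move=> t1 IH1 c /IH1[p1 E1]; exists (p1 *+ c) => v; rewrite mevalMn E1.
- move=> t1 IH1 t2 IH2 /andP[/IH1[p1 E1] /IH2[p2 E2]].
  by exists (p1 * p2) => v; rewrite mevalM E1 E2.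
by move=> t1 IH1 c /IH1[p1 E1]; exists (p1 ^+ c) => v; rewrite rmorphXn E1.
Qed.

(** An equation between polynomials either holds everywhere or fails off the zeros of the nonzero
    difference; for connectives the two exceptional polynomials are multiplied. *)
Lemma qf_dichotomy k (f : GRing.formula F) : GRing.qf_form f && GRing.rformula f ->
  exists b, exists2 p : {mpoly F[k]}, (exists u, p.@[u] != 0) &
    forall v, p.@[v] != 0 -> GRing.qf_eval (env v) f = b.
Proof.
pose gen (f : seq F -> bool) := exists b, exists2 p : {mpoly F[k]},
  (exists u, p.@[u] != 0) & forall v, p.@[v] != 0 -> f (env v) = b.
have binop op f1 f2 : gen f1 -> gen f2 -> gen (fun e => op (f1 e) (f2 e)).
  move=> [b1 [p1 [u1 n1] E1]] [b2 [p2 [u2 n2] E2]].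
  exists (op b1 b2), (p1 * p2).
    by have [t nt] := meval_neq0_mul n1 n2; exists (fun i => u1 i + t * (u2 i - u1 i)).
  by move=> v; rewrite mevalM mulf_eq0 negb_or => /andP[/E1 -> /E2 ->].
elim: f => //=.
- move=> b _; exists b, 1 => //.
  by exists (fun=> 0); rewrite meval1 oner_neq0.
- move=> t1 t2 /andP[/(rterm_mpoly k)[p1 E1] /(rterm_mpoly k)[p2 E2]].
  case: (classic (exists u, (p1 - p2).@[u] != 0)) => [ex|nex].
    exists false, (p1 - p2) => // v.
    by rewrite mevalB subr_eq0 E1 E2 => /negPf.
  exists true, 1; first by exists (fun=> 0); rewrite meval1 oner_neq0.
  move=> v _.
  rewrite E1 E2; apply/eqP; apply: NNPP => ne; case: nex; exists v.
  by rewrite mevalB subr_eq0; apply/eqP.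
- move=> f1 IH1 f2 IH2 /andP[/andP[q1 q2] /andP[r1 r2]].
  have {}IH1 := IH1 (introT andP (conj q1 r1)).
  have {}IH2 := IH2 (introT andP (conj q2 r2)).
  exact: (binop andb (fun e => GRing.qf_eval e f1) (fun e => GRing.qf_eval e f2) IH1 IH2).
- move=> f1 IH1 f2 IH2 /andP[/andP[q1 q2] /andP[r1 r2]].
  have {}IH1 := IH1 (introT andP (conj q1 r1)).
  have {}IH2 := IH2 (introT andP (conj q2 r2)).
  exact: (binop orb (fun e => GRing.qf_eval e f1) (fun e => GRing.qf_eval e f2) IH1 IH2).
- move=> f1 IH1 f2 IH2 /andP[/andP[q1 q2] /andP[r1 r2]].
  have {}IH1 := IH1 (introT andP (conj q1 r1)).
  have {}IH2 := IH2 (introT andP (conj q2 r2)).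
  exact: (binop implb (fun e => GRing.qf_eval e f1) (fun e => GRing.qf_eval e f2) IH1 IH2).
by move=> f1 IH1 /IH1[b [p np E]]; exists (~~ b), p => // v /E ->.
Qed.

(* Quantifier elimination makes every definable subset of affine space
   constructible, and affine space is irreducible. *)
Lemma holds_dichotomy k (f : GRing.formula F) :
  exists2 p : {mpoly F[k]}, (exists u, p.@[u] != 0) &
    (forall v, p.@[v] != 0 -> GRing.holds (env v) f) \/
    (forall v, p.@[v] != 0 -> ~ GRing.holds (env v) f).
Proof.
(* [GRing.to_rform] trades inverses for quantified variables, so that the elimination meets ring
   terms only. *)
pose q := GRing.quantifier_elim (@ClosedFieldQE.ex_elim F) (GRing.to_rform f).
have qP e : reflect (GRing.holds e f) (GRing.qf_eval e q).
  apply: (iffP (GRing.quantifier_elim_rformP (@ClosedFieldQE.wf_ex_elim F)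
    (ClosedFieldQE.holds_ex_elim (@solve_monicpoly F)) e (GRing.to_rform_rformula f)));
  by move/GRing.to_rformP.
have qf_q := GRing.quantifier_elim_wf (@ClosedFieldQE.wf_ex_elim F) (GRing.to_rform_rformula f).
have [b [p np E]] := qf_dichotomy k qf_q; exists p => //.
by case: b E => E; [left|right] => v /E Ev; apply/qP; rewrite Ev.
Qed.

End ClosedField.

(* Instances: functions represented by polynomials, by polynomials whose
   coefficients are polynomials, and by first-order terms. *)
Record funring X (B : comNzRingType) (C : (X -> B) -> Prop) : Prop := FunRing {
  fr_ext : forall f g, f =1 g -> C f -> C g;
  fr_cst : forall c, C (fun=> c);
  fr_add : forall f g, C f -> C g -> C (fun x => f x + g x);
  fr_mul : forall f g, C f -> C g -> C (fun x => f x * g x)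
}.

(** * Closure of function rings under matrix operations and substitution *)

Section FunRingTheory.
Variables (X : Type) (B : comNzRingType) (C : (X -> B) -> Prop).
Hypothesis frC : funring C.

Lemma fr_opp f : C f -> C (fun x => - f x).
Proof.
move=> Cf; apply: (fr_ext frC) (fr_mul frC (fr_cst frC (-1)) Cf) => x.
by rewrite mulN1r.
Qed.

Lemma fr_sub f g : C f -> C g -> C (fun x => f x - g x).
Proof. by move=> Cf Cg; apply: (fr_add frC Cf (fr_opp Cg)). Qed.

Lemma fr_sum I (r : seq I) (P : pred I) (f : I -> X -> B) :
  (forall i, C (f i)) -> C (fun x => \sum_(i <- r | P i) f i x).
Proof.
move=> Cf; elim: r => [|i r IH].
  by apply: (fr_ext frC) (fr_cst frC 0) => x; rewrite big_nil.
case Pi: (P i).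
  by apply: (fr_ext frC) (fr_add frC (Cf i) IH) => x; rewrite big_cons Pi.
by apply: (fr_ext frC) IH => x; rewrite big_cons Pi.
Qed.

Lemma fr_prod I (r : seq I) (P : pred I) (f : I -> X -> B) :
  (forall i, C (f i)) -> C (fun x => \prod_(i <- r | P i) f i x).
Proof.
move=> Cf; elim: r => [|i r IH].
  by apply: (fr_ext frC) (fr_cst frC 1) => x; rewrite big_nil.
case Pi: (P i).
  by apply: (fr_ext frC) (fr_mul frC (Cf i) IH) => x; rewrite big_cons Pi.
by apply: (fr_ext frC) IH => x; rewrite big_cons Pi.
Qed.

Lemma fr_exp f k : C f -> C (fun x => f x ^+ k).
Proof.
move=> Cf; elim: k => [|k IH]; first exact: fr_cst.
by apply: (fr_ext frC) (fr_mul frC Cf IH) => x; rewrite exprS.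
Qed.

Lemma fr_det k (A : X -> 'M[B]_k) :
  (forall i j, C (fun x => A x i j)) -> C (fun x => \det (A x)).
Proof.
move=> CA; apply: fr_sum => s; apply: fr_mul => //; first exact: fr_cst.
by apply: fr_prod.
Qed.

Lemma fr_adj k (A : X -> 'M[B]_k) a b :
  (forall i j, C (fun x => A x i j)) -> C (fun x => (\adj (A x)) a b).
Proof.
move=> CA; apply: (@fr_ext _ _ _ frC (fun x => cofactor (A x) b a)).
  by move=> x; rewrite mxE.
apply: fr_mul => //; first exact: fr_cst.
apply: fr_det => i j; apply: (fr_ext frC) (CA (lift b i) (lift a j)) => x.
by rewrite !mxE.
Qed.

Lemma fr_mulmx k l r (M : X -> 'M[B]_(k, l)) (N : X -> 'M[B]_(l, r)) :
  (forall i j, C (fun x => M x i j)) -> (forall i j, C (fun x => N x i j)) ->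
  forall i j, C (fun x => (M x *m N x) i j).
Proof.
move=> CM CN i j; apply: (@fr_ext _ _ _ frC (fun x => \sum_l M x i l * N x l j)).
  by move=> x; rewrite mxE.
by apply: fr_sum => l'; apply: fr_mul.
Qed.

Lemma fr_tr k (M : X -> 'M[B]_k) :
  (forall i j, C (fun x => M x i j)) -> C (fun x => \tr (M x)).
Proof. by move=> CM; apply: fr_sum. Qed.

Lemma fr_mmap (F : nzRingType) k (c : F -> B) (p : {mpoly F[k]}) (h : 'I_k -> X -> B) :
  (forall i, C (h i)) -> C (fun x => mmap c (fun i => h i x) p).
Proof.
move=> Ch; apply: fr_sum => mm; apply: fr_mul => //; first exact: fr_cst.
by apply: fr_prod => i; apply: fr_exp.
Qed.

End FunRingTheory.

Lemma fr_meval X (F : comNzRingType) (C : (X -> F) -> Prop) (frC : funring C)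
    k (p : {mpoly F[k]}) (h : X -> 'I_k -> F) :
  (forall i, C (h^~ i)) -> C (fun x => p.@[h x]).
Proof. by move=> Ch; apply: (fr_mmap frC idfun p (h := fun i x => h x i)). Qed.

Lemma fr_horner X (F : comNzRingType) (C : (X -> F) -> Prop) (frC : funring C)
    k (P : {poly {mpoly F[k]}}) (h : X -> 'I_k -> F) (t : X -> F) :
  (forall i, C (h^~ i)) -> C t -> C (fun x => (map_poly (meval (h x)) P).[t x]).
Proof.
move=> Ch Ct.
apply: (@fr_ext _ _ _ frC (fun x => \sum_(i < size P) (P`_i).@[h x] * t x ^+ i)).
  move=> x; rewrite (@horner_coef_wide _ (size P)) ?size_poly //.
  by apply: eq_bigr => i _; rewrite coef_map.
apply: fr_sum => // i; apply: fr_mul => //; first exact: fr_meval.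
exact: fr_exp.
Qed.

Definition representable X (A B : comNzRingType) (ev : X -> {rmorphism A -> B})
  (f : X -> B) : Prop := exists a, forall x, f x = ev x a.

Lemma representable_funring X (A B : comNzRingType) (ev : X -> {rmorphism A -> B}) :
  (forall c, representable ev (fun=> c)) -> funring (representable ev).
Proof.
move=> cst; split=> // [f g fg [a E]|f g [a Ea] [b Eb]|f g [a Ea] [b Eb]].
- by exists a => x; rewrite -fg.
- by exists (a + b) => x; rewrite rmorphD Ea Eb.
by exists (a * b) => x; rewrite rmorphM Ea Eb.
Qed.

Definition polyfun (F : comNzRingType) X k (v : X -> 'I_k -> F) :=
  representable (fun x => meval (v x) : {rmorphism {mpoly F[k]} -> F}).

Lemma polyfun_funring (F : comNzRingType) X k (v : X -> 'I_k -> F) :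
  funring (polyfun v).
Proof. by apply: representable_funring => c; exists c%:MP => x /=; rewrite mevalC. Qed.

Lemma polyfun_var (F : comNzRingType) X k (v : X -> 'I_k -> F) i :
  polyfun v (v^~ i).
Proof. by exists 'X_i => x /=; rewrite mevalXU. Qed.

(** * Polynomial functions of a matrix, Zariski closure and genericity *)

Definition mxpolyfun n := polyfun (fun (A : 'M[CC]_n) i => mxvec A 0 i).

Lemma mxpolyfun_funring n : funring (@mxpolyfun n).
Proof. exact: polyfun_funring. Qed.

Lemma mxpolyfun_entry n a b : mxpolyfun (fun A : 'M[CC]_n => A a b).
Proof.
have [p E] := polyfun_var (fun (A : 'M[CC]_n) i => mxvec A 0 i) (mxvec_index a b).
by exists p => A; rewrite -E mxvecE.
Qed.

Lemma mxpolyfun_comp n (f : 'M[CC]_n -> CC) (g : 'M[CC]_n -> 'M[CC]_n) :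
  mxpolyfun f -> (forall a b, mxpolyfun (fun A => g A a b)) ->
  mxpolyfun (fun A => f (g A)).
Proof.
move=> [p E] Cg; apply: (fr_ext (@mxpolyfun_funring n)) => [A|]; first by rewrite E.
apply: (fr_meval (@mxpolyfun_funring n)) => i; case/mxvec_indexP: i => a b.
by apply: (fr_ext (@mxpolyfun_funring n)) (Cg a b) => A; rewrite mxvecE.
Qed.

Lemma zclosureP n (P : 'M[CC]_n -> Prop) (f : 'M[CC]_n -> CC) :
  mxpolyfun f -> (forall Y, P Y -> f Y = 0) -> forall Y, zclosure P Y -> f Y = 0.
Proof.
by move=> [p E] Pf Y /(_ p) zY; rewrite E; apply: zY => Z /Pf; rewrite E.
Qed.

Lemma notin_zclosure n (P : 'M[CC]_n -> Prop) Y : ~ zclosure P Y ->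
  exists f, [/\ mxpolyfun f, forall Z, P Z -> f Z = 0 & f Y != 0].
Proof.
move=> nY; apply: NNPP => nex; apply: nY => p pP.
apply: NNPP => /eqP pY; apply: nex; exists (mxeval p); split => //.
by exists p.
Qed.

Lemma two_neq0 : (2%:R : CC) != 0.
Proof. by rewrite (Num.Theory.pnatr_eq0 (Rdefinitions.R[i])). Qed.

Lemma generic_polyfun n (P : 'M[CC]_n -> Prop) (f : 'M[CC]_n -> CC) :
  mxpolyfun f -> (exists2 S0, symm S0 & f S0 != 0) ->
  (forall S, symm S -> f S != 0 -> P S) -> generic P.
Proof.
move=> [p E] [S0 sS0 f0] fP; exists p; split.
  by exists S0 => //; rewrite E in f0.
by move=> S sS pS; apply: fP => //; rewrite E.
Qed.

Lemma generic_sub n (P Q : 'M[CC]_n -> Prop) :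
  (forall S, symm S -> P S -> Q S) -> generic P -> generic Q.
Proof.
by move=> PQ [f [ex fP]]; exists f; split => // S sS /(fP S sS); apply: PQ.
Qed.

Lemma generic_and n (P Q : 'M[CC]_n -> Prop) :
  generic P -> generic Q -> generic (fun S => P S /\ Q S).
Proof.
move=> [f [[S0 s0 f0] fP]] [g [[S1 s1 g1] gQ]]; exists (f * g); split; last first.
  move=> S sS; rewrite /mxeval mevalM mulf_eq0 negb_or => /andP[fS gS].
  by split; [apply: fP|apply: gQ].
have [t nt] := meval_neq0_mul f0 g1.
exists (S0 + t *: (S1 - S0)); first by rewrite /symm linearD linearZ linearB /= s0 s1.
apply: contraNneq nt; rewrite /mxeval => E; apply/eqP; rewrite -[RHS]E.
by apply: meval_eq => i; rewrite linearD linearZ linearB /= !mxE.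
Qed.

Lemma generic_all n (I : finType) (P : I -> 'M[CC]_n -> Prop) :
  (forall i, generic (P i)) -> generic (fun S => forall i, P i S).
Proof.
move=> gP.
suff: forall r : seq I, generic (fun S => forall i, i \in r -> P i S).
  by move/(_ (enum I)); apply: generic_sub => S _ H i; apply: H; rewrite mem_enum.
elim=> [|i r IH].
  apply: (generic_polyfun (fr_cst (@mxpolyfun_funring n) 1)) => //.
  by exists 0; rewrite ?oner_neq0 /symm ?trmx0.
apply: generic_sub (generic_and (gP i) IH) => S _ [Pi Pr] j.
by rewrite inE => /orP[/eqP ->|/Pr].
Qed.

Lemma generic_ex n (P : 'M[CC]_n -> Prop) : generic P -> exists2 S, symm S & P S.
Proof. by move=> [f [[S0 s0 f0] fP]]; exists S0 => //; apply: fP. Qed.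


(** * First-order definable conditions on matrices *)

Section Definable.
Variable F : closedFieldType.

Definition termfun (f : seq F -> F) : Prop :=
  exists t, forall e, f e = GRing.eval e t.

Definition definable (D : seq F -> Prop) : Prop :=
  exists f, forall e, D e <-> GRing.holds e f.

Lemma termfun_funring : funring termfun.
Proof.
split=> [f g fg [t E]|c|f g [t E] [t' E']|f g [t E] [t' E']].
- by exists t => e; rewrite -fg.
- by exists (GRing.Const c).
- by exists (GRing.Add t t') => e; rewrite E E'.
by exists (GRing.Mul t t') => e; rewrite E E'.
Qed.

Lemma termfun_var i : termfun (fun e => e`_i).
Proof. by exists (GRing.Var F i). Qed.

Lemma termfun_inv f : termfun f -> termfun (fun e => (f e)^-1).
Proof. by move=> [t E]; exists (GRing.Inv t) => e; rewrite E. Qed.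

Lemma definable_eq f g : termfun f -> termfun g -> definable (fun e => f e = g e).
Proof. by move=> [t E] [t' E']; exists (GRing.Equal t t') => e; rewrite E E'. Qed.

Lemma definable_not D : definable D -> definable (fun e => ~ D e).
Proof. by move=> [f E]; exists (GRing.Not f) => e /=; rewrite E. Qed.

Lemma definable_and D D' :
  definable D -> definable D' -> definable (fun e => D e /\ D' e).
Proof. by move=> [f E] [f' E']; exists (GRing.And f f') => e /=; rewrite E E'. Qed.

Lemma definable_all (I : finType) (D : I -> seq F -> Prop) :
  (forall i, definable (D i)) -> definable (fun e => forall i, D i e).
Proof.
move=> defD.
have [f E] : exists f, forall e, (forall i, i \in enum I -> D i e) <-> GRing.holds e f.
  elim: (enum I) => [|i r [f E]]; first by exists (GRing.Bool true) => e; split.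
  have [g Eg] := defD i; exists (GRing.And g f) => e /=; rewrite -Eg -E; split.
    by move=> H; split=> [|j jr]; apply: H; rewrite inE ?eqxx ?jr ?orbT.
  by move=> [Hi Hr] j; rewrite inE => /orP[/eqP ->|/Hr].
by exists f => e; rewrite -E; split=> H i; [|apply: H; rewrite mem_enum].
Qed.

Lemma definable_imp (b : bool) D : definable D -> definable (fun e => b -> D e).
Proof.
by move=> [f E]; exists (GRing.Implies (GRing.Bool b) f) => e /=; rewrite E.
Qed.

(** A formula names the variables it binds by index, so the length [N] of [e] is fixed beforehand
    and the entries of [w] are bound as the variables from [N] on. *)
Lemma definable_ex_seq N k D : definable D ->
  exists f, forall e, size e = N ->
    GRing.holds e f <-> exists2 w, size w = k & D (e ++ w).
Proof.
elim: k D => [|k IH] D [f E].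
  exists f => e _; rewrite -E; split=> [De|[w /size0nil ->]].
    by exists [::]; rewrite ?cats0.
  by rewrite cats0.
have [|g Eg] := IH (fun e => exists x, D (set_nth 0 e (N + k) x)).
  exists (GRing.Exists (N + k) f) => e /=.
  by split=> -[x]; [rewrite E|rewrite -E] => H; exists x.
have cat_set e w x : size e = N -> size w = k ->
    set_nth 0 (e ++ w) (N + k) x = e ++ rcons w x.
  move=> se sw; rewrite -rcons_cat -se -sw -size_cat.
  by rewrite set_nthE ltnn subnn /= -cats1.
exists g => e se; rewrite Eg //; split.
  move=> [w sw [x]]; rewrite cat_set // => De.
  by exists (rcons w x); rewrite // size_rcons sw.
move=> [w]; case/lastP: w => // w x; rewrite size_rcons => -[sw] De.
by exists w => //; exists x; rewrite cat_set.
Qed.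

Definition seq_mx k l (o : nat) (e : seq F) : 'M[F]_(k, l) :=
  \matrix_(i, j) e`_(o + mxvec_index i j).

Lemma seq_mx_entry k l o i j : termfun (fun e => seq_mx k l o e i j).
Proof.
apply: (fr_ext termfun_funring) (termfun_var (o + mxvec_index i j)) => e.
by rewrite mxE.
Qed.

Lemma definable_ex_mx n k l (Q : 'M[F]_n -> 'M[F]_(k, l) -> Prop) :
  definable (fun e => Q (seq_mx n n 0 e) (seq_mx k l (n * n) e)) ->
  exists f, forall A, GRing.holds (env (fun i => mxvec A 0 i)) f <-> exists x, Q A x.
Proof.
move=> /(definable_ex_seq (n * n) (k * l)) [f E]; exists f => A.
rewrite E ?size_env //; set e := env _.
have seA w : seq_mx n n 0 (e ++ w) = A.
  apply/matrixP => i j; rewrite mxE add0n nth_cat size_env ltn_ord.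
  by rewrite /e nth_env mxvecE.
split=> [[w sw]|[x Qx]]; first by rewrite seA => Q'; eexists; apply: Q'.
exists (env (fun i => mxvec x 0 i)); first by rewrite size_env.
rewrite seA; suff -> : seq_mx k l (n * n) (e ++ env (fun i => mxvec x 0 i)) = x by [].
apply/matrixP => i j; rewrite mxE nth_cat size_env ltnNge leq_addr addKn.
exact: etrans (nth_env _ _) (mxvecE _ _ _).
Qed.

End Definable.

(* A symmetric matrix S is the symmetric part of S plus any skew matrix; thus
   a nonzero polynomial on all matrices yields a nonzero one on S^n. *)
Lemma generic_dichotomy n k l (Q : 'M[CC]_n -> 'M[CC]_(k, l) -> Prop) :
  definable (fun e => Q (2%:R^-1 *: (seq_mx n n 0 e + (seq_mx n n 0 e)^T))
                        (seq_mx k l (n * n) e)) ->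
  generic (fun S => exists x, Q S x) \/ generic (fun S => ~ exists x, Q S x).
Proof.
move/(@definable_ex_mx _ n k l (fun A => Q (2%:R^-1 *: (A + A^T)))) => [f E].
have [p [u pu] pf] := holds_dichotomy (n * n) f.
pose A0 := vec_mx (\row_i u i); pose T := 2%:R^-1 *: (A0 - A0^T).
have halfD (A : 'M[CC]_n) : 2%:R^-1 *: (A + A) = A.
  have -> : A + A = 2%:R *: A by rewrite scaler_nat mulr2n.
  by rewrite scalerA mulVf ?two_neq0 // scale1r.
have symS S : symm S -> 2%:R^-1 *: ((S + T) + (S + T)^T) = S.
  move=> sS; have tT : T^T = - T by rewrite /T linearZ linearB /= trmxK -scalerN opprB.
  by rewrite [(S + T)^T]linearD /= sS tT addrACA subrr addr0 halfD.
have polf : mxpolyfun (fun S => p.@[fun i => mxvec (S + T) 0 i]).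
  apply: (fr_meval (@mxpolyfun_funring n)) => i; case/mxvec_indexP: i => a b.
  apply: (fr_ext (@mxpolyfun_funring n))
    (fr_add (@mxpolyfun_funring n) (mxpolyfun_entry a b)
            (fr_cst (@mxpolyfun_funring n) (T a b))) => A.
  by rewrite mxvecE [RHS]mxE.
have pol0 : exists2 S0, symm S0 & p.@[fun i => mxvec (S0 + T) 0 i] != 0.
  exists (2%:R^-1 *: (A0 + A0^T)).
    by rewrite /symm linearZ linearD /= trmxK addrC.
  apply: contraNneq pu => <-; apply/eqP/meval_eq => i.
  by rewrite /T -scalerDr addrACA subrr addr0 halfD vec_mxK mxE.
case: pf => pf; [left|right]; apply: (generic_polyfun polf pol0) => S sS pS.
  by have /E := pf _ pS; rewrite symS.
by have := pf _ pS; rewrite E symS.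
Qed.

Lemma invmx_adj (R : comUnitRingType) n (K : 'M[R]_n) :
  K \in unitmx -> invmx K = (\det K)^-1 *: \adj K.
Proof. by rewrite /invmx => ->. Qed.

Lemma mxvec_dot (R : comNzRingType) n (A Z : 'M[R]_n) :
  \sum_i mxvec A 0 i * mxvec Z 0 i = \tr (A *m Z^T).
Proof.
rewrite (reindex _ (curry_mxvec_bij _ _)) /mxtrace /=.
transitivity (\sum_a \sum_b A a b * Z a b).
  by rewrite pair_bigA; apply: eq_bigr => [[a b]] _ /=; rewrite !mxvecE.
by apply: eq_bigr => a _; rewrite mxE; apply: eq_bigr => b _; rewrite mxE.
Qed.

Lemma tr_delta_mx (R : comNzRingType) n (c d : 'I_n) (G : 'M[R]_n) :
  \tr (delta_mx c d *m G^T) = G c d.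
Proof.
rewrite /mxtrace (bigD1 c) //= mxE (bigD1 d) //= !mxE !eqxx mul1r.
rewrite big1 => [|k kd]; last by rewrite !mxE (negPf kd) andbF mul0r.
rewrite addr0 big1 ?addr0 // => k kc; rewrite mxE big1 // => l _.
by rewrite !mxE (negPf kc) mul0r.
Qed.

Lemma card_ltn_ord2 n : #|[pred p : 'I_n * 'I_n | (p.1 < p.2)%N]| = 'C(n, 2).
Proof.
rewrite -sum1_card -triangular_sum big_mkord.
rewrite -(pair_big_dep xpredT (fun a b : 'I_n => (a < b)%N) (fun _ _ => 1%N)) /=.
rewrite (exchange_big_dep xpredT) //=; apply: eq_bigr => b _.
rewrite sum1_card -[RHS]card_ord -(card_codom (f := widen_ord (ltnW (ltn_ord b)))).
  apply: eq_card => a; rewrite unfold_in; apply/idP/codomP => [ab|[c ->]] /=.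
    by exists (Ordinal ab); apply: val_inj.
  exact: ltn_ord.
by move=> x y /(congr1 val) /= E; apply: val_inj.
Qed.

(** * The reciprocal variety and its pairings with a basis of [L] *)

Section Reciprocal.
Variables (n : nat) (L : {vspace 'M[CC]_n}).
Hypothesis L_sym : forall K, K \in L -> symm K.
Let m := \dim L.
Implicit Types (X S G : 'M[CC]_n) (x y : 'I_m -> CC).

Definition lincomb x : 'M[CC]_n := \sum_j x j *: (vbasis L)`_j.

Definition pairing X (j : 'I_m) : CC := \tr ((vbasis L)`_j *m X).

Lemma basis_mem (j : 'I_m) : (vbasis L)`_j \in L.
Proof. by apply: vbasis_mem; rewrite mem_nth // size_tuple. Qed.

Lemma lincomb_mem x : lincomb x \in L.
Proof. by apply: memv_suml => j _; rewrite memvZ ?basis_mem. Qed.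

Lemma lincombP K : K \in L -> exists x, K = lincomb x.
Proof. by move=> KL; exists (fun j => coord (vbasis L) j K); apply: coord_vbasis. Qed.

Lemma lincomb_inj x y : lincomb x = lincomb y -> x =1 y.
Proof.
move=> E j; apply/eqP; rewrite -subr_eq0; apply/eqP.
have /freeP fr := basis_free (vbasisP L); apply: (fr (fun j => x j - y j)).
transitivity (lincomb x - lincomb y); last by rewrite E subrr.
by rewrite /lincomb -sumrB; apply: eq_bigr => i _; rewrite scalerBl.
Qed.

Lemma pairingD X S j : pairing (X + S) j = pairing X j + pairing S j.
Proof. by rewrite /pairing mulmxDr linearD. Qed.

Lemma pairingZ c X j : pairing (c *: X) j = c * pairing X j.
Proof. by rewrite /pairing -scalemxAr linearZ. Qed.

Lemma pairingB X S j : pairing (X - S) j = pairing X j - pairing S j.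
Proof. by rewrite pairingD -scaleN1r pairingZ mulN1r. Qed.

Lemma polarP G : polar L G <-> symm G /\ forall j, pairing G j = 0.
Proof.
split=> -[sG H]; split=> //; first by move=> j; apply/H/basis_mem.
move=> K /lincombP[x ->].
rewrite mulmx_suml raddf_sum big1 // => j _ /=.
by rewrite -scalemxAl linearZ /= [\tr _](H j) mulr0.
Qed.

Lemma fr_lincomb T (C : (T -> CC) -> Prop) (frC : funring C) (x : T -> 'I_m -> CC) a b :
  (forall j, C (x^~ j)) -> C (fun z => lincomb (x z) a b).
Proof.
move=> Cx; apply: (@fr_ext _ _ _ frC (fun z => \sum_j x z j * (vbasis L)`_j a b)).
  by move=> z; rewrite summxE; apply: eq_bigr => j _; rewrite mxE.
by apply: (fr_sum frC) => j; apply: (fr_mul frC) => //; apply: fr_cst.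
Qed.

Lemma fr_pairing T (C : (T -> CC) -> Prop) (frC : funring C) (M : T -> 'M[CC]_n) j :
  (forall a b, C (fun z => M z a b)) -> C (fun z => pairing (M z) j).
Proof.
move=> CM; apply: (fr_tr frC); apply: (fr_mulmx frC) => // a b; exact: fr_cst.
Qed.

Lemma mxpolyfun_pairing j : mxpolyfun (fun X => pairing X j).
Proof. by apply: (fr_pairing (@mxpolyfun_funring n)) => a b; apply: mxpolyfun_entry. Qed.

Lemma recip_inv K : K \in L -> K \in unitmx -> recip L (invmx K).
Proof. by move=> KL Ku p; apply; exists K. Qed.

Lemma recip_vanish f : mxpolyfun f ->
  (forall K, K \in L -> K \in unitmx -> f (invmx K) = 0) ->
  forall X, recip L X -> f X = 0.
Proof.
move=> pf H X; apply: (zclosureP pf) => Y [K KL [Ku ->]]; exact: H.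
Qed.

Lemma recip_symm X : recip L X -> symm X.
Proof.
move=> rX; apply/matrixP => a b; rewrite mxE; apply/eqP; rewrite -subr_eq0; apply/eqP.
apply: (recip_vanish (f := fun X => X b a - X a b)) rX.
  by apply: (fr_sub (@mxpolyfun_funring n)); apply: mxpolyfun_entry.
move=> K KL Ku; apply/eqP; rewrite subr_eq0; apply/eqP.
by rewrite -[in LHS](L_sym KL) -trmx_inv mxE.
Qed.

(** That [\adj X] is fixed by the projection onto [L] is a polynomial condition on [X]. It holds at
    the inverse of [K], whose adjugate is a multiple of [K], hence on the closure. *)
Lemma recip_invmx_mem X : recip L X -> X \in unitmx -> invmx X \in L.
Proof.
move=> rX Xu; rewrite invmx_adj // memvZ //.
have -> : \adj X = projv L (\adj X); last exact: memv_proj.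
apply/matrixP => a b; apply/eqP; rewrite -subr_eq0; apply/eqP.
have frn := @mxpolyfun_funring n.
apply: (recip_vanish (f := fun X => (\adj X) a b - (projv L (\adj X)) a b)) rX.
  apply: (fr_sub frn); first by apply: (fr_adj frn) => i j; apply: mxpolyfun_entry.
  apply: (@fr_ext _ _ _ frn (fun X => \sum_i \sum_j (\adj X) i j *
     (projv L (delta_mx i j)) a b)).
    move=> Z; rewrite [in RHS](matrix_sum_delta (\adj Z)) linear_sum summxE /=.
    apply: eq_bigr => i _; rewrite linear_sum summxE; apply: eq_bigr => j _.
    by rewrite linearZ [RHS]mxE.
  apply: (fr_sum frn) => i; apply: (fr_sum frn) => j; apply: (fr_mul frn).
    by apply: (fr_adj frn) => k l; apply: mxpolyfun_entry.
  exact: fr_cst.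
move=> K KL Ku; apply/eqP; rewrite subr_eq0; apply/eqP.
suff -> : \adj (invmx K) = \det (invmx K) *: K by rewrite projv_id // memvZ.
have iKu : invmx K \in unitmx by rewrite unitmx_inv.
have KE := invmx_adj iKu; rewrite invmxK in KE.
move: (invmx K) iKu KE => Y; rewrite unitmxE unitfE => dY ->.
by rewrite scalerA mulfV ?scale1r.
Qed.

(** Needed because a line of J determines its points only up to a factor. Scaling is a polynomial
    map that preserves the set of inverses. *)
Lemma recip_scale c X : c != 0 -> recip L X -> recip L (c *: X).
Proof.
move=> c0 rX; apply: NNPP => /notin_zclosure[f [pf fP fX]].
case/eqP: fX; apply: (recip_vanish (f := fun X => f (c *: X))) rX.
  apply: (mxpolyfun_comp (g := fun X => c *: X)) => // a b.
  apply: (fr_ext (@mxpolyfun_funring n))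
    (fr_mul (@mxpolyfun_funring n) (fr_cst (@mxpolyfun_funring n) c)
    (mxpolyfun_entry a b)) => Z; by rewrite mxE.
move=> K KL Ku; apply: fP; exists (c^-1 *: K); first by rewrite memvZ.
have Cu : c^-1 \is a GRing.unit by rewrite unitfE invr_eq0.
by split; [rewrite unitmxZ|rewrite invmxZ ?unitmxZ // invrK].
Qed.

(** At the inverse of [lincomb x], the function [f] and the [m] pairings are fractions in [m]
    variables with the common denominator [\det (lincomb x)], so they are algebraically
    dependent. *)
Lemma recip_relation f (g0 : {mpoly CC[m]}) : mxpolyfun f ->
  (forall x, lincomb x \in unitmx ->
     f (invmx (lincomb x)) = g0.@[x] / \det (lincomb x)) ->
  exists2 P : {poly {mpoly CC[m]}}, P != 0 &
    forall X, recip L X -> (map_poly (meval (pairing X)) P).[f X] = 0.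
Proof.
move=> pf fE.
have frm := polyfun_funring (id : ('I_m -> CC) -> 'I_m -> CC).
have lin_entry a b : polyfun id (fun x => lincomb x a b).
  by apply: (fr_lincomb frm) => j; apply: (polyfun_var id).
have [h hE] := fr_det frm lin_entry.
have /fin_all_exists[g gE] : forall j : 'I_m, exists g : {mpoly CC[m]},
    forall x, pairing (\adj (lincomb x)) j = g.@[x].
  by move=> j; apply: (fr_pairing frm) => a b; apply: (fr_adj frm).
have [P P0 PE] := algebraic_dependence h g0 g; exists P => //.
apply: (recip_vanish (f := fun X => (map_poly (meval (pairing X)) P).[f X])).
  apply: (fr_horner (@mxpolyfun_funring n)) => // j; exact: mxpolyfun_pairing.
move=> K /lincombP[x ->] Ku.
have hx : h.@[x] != 0 by have := Ku; rewrite unitmxE unitfE hE.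
rewrite fE // hE -[RHS](PE x hx); congr (_.[_]).
apply: eq_map_poly => q; apply: meval_eq => j.
by rewrite invmx_adj // pairingZ gE hE mulrC.
Qed.

Lemma recip_entry_relation a b :
  exists2 P : {poly {mpoly CC[m]}}, P != 0 &
    forall X, recip L X -> (map_poly (meval (pairing X)) P).[X a b] = 0.
Proof.
have frm := polyfun_funring (id : ('I_m -> CC) -> 'I_m -> CC).
have lin_entry i j : polyfun id (fun x => lincomb x i j).
  by apply: (fr_lincomb frm) => l; apply: (polyfun_var id).
have [g gE] := fr_adj frm a b lin_entry.
apply: (recip_relation (g0 := g)); first exact: mxpolyfun_entry.
by move=> x xu; rewrite invmx_adj // mxE gE mulrC.
Qed.

(* Powers of T can be removed from a relation P(det X, pairing X) = 0, because det
   does not vanish on the inverses. *)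
Lemma recip_det_relation :
  exists2 q : {mpoly CC[m]}, q != 0 &
    forall X, recip L X -> \det X = 0 -> q.@[pairing X] = 0.
Proof.
have frn := @mxpolyfun_funring n.
have pdet : mxpolyfun (fun X => \det X).
  by apply: (fr_det frn) => i j; apply: mxpolyfun_entry.
have [|P P0 PE] := recip_relation (g0 := 1) pdet.
  by move=> x xu; rewrite det_inv meval1 mul1r.
have exk : exists k, P`_k != 0.
  by exists (size P).-1; rewrite -lead_coefE lead_coef_eq0.
case: (ex_minnP exk) => k Pk kmin.
exists P`_k => // X rX dX.
have PXk : P = drop_poly k P * 'X^k.
  rewrite -{1}(poly_take_drop k P) (_ : take_poly k P = 0) ?add0r //.
  apply/polyP => i; rewrite coef_take_poly coef0; case: ltnP => // ik.
  by apply/eqP; apply: contraTT ik => Pi; rewrite -leqNgt kmin.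
have : (map_poly (meval (pairing X)) (drop_poly k P)).[\det X] = 0.
  move: X rX {dX}.
  apply: (recip_vanish (f := fun X => (map_poly (meval (pairing X)) (drop_poly k P)).[\det X])).
    by apply: (fr_horner frn) => // j; apply: mxpolyfun_pairing.
  move=> K KL Ku; have := PE _ (recip_inv KL Ku).
  rewrite {1}PXk rmorphM /= map_polyXn hornerM hornerXn => /eqP.
  rewrite mulf_eq0 expf_eq0 det_inv invr_eq0 => /orP[/eqP //|/andP[_ /eqP d0]].
  by move: Ku; rewrite unitmxE d0 unitr0.
by rewrite dX horner_coef0 coef_map coef_drop_poly add0n.
Qed.

(** A right inverse of the matrix of vectorized basis elements yields a solution [Z], perhaps not
    symmetric. As the basis is symmetric, [Z] and its transpose have the same pairings, and their
    mean is a symmetric solution. *)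
Lemma pairing_surj y : exists2 S, symm S & forall j, pairing S j = y j.
Proof.
pose M : 'M[CC]_(m, n * n) := \matrix_(j < m) mxvec (vbasis L)`_j.
have /row_freeP[R MR] : row_free M.
  apply: inj_row_free => v vM; apply/rowP => j; rewrite mxE.
  have /freeP fr := basis_free (vbasisP L); apply: (fr (fun j => v 0 j)).
  apply: (can_inj mxvecK); rewrite linear0 -vM linear_sum.
  apply/rowP => i; rewrite summxE mxE; apply: eq_bigr => l _.
  by rewrite linearZ !mxE.
pose c := R *m (\col_j y j); pose Z : 'M[CC]_n := vec_mx c^T.
have Zy (j : 'I_m) : \tr ((vbasis L)`_j *m Z^T) = y j.
  rewrite -mxvec_dot.
  have : (M *m c) j 0 = y j by rewrite mulmxA MR mul1mx mxE.
  by rewrite mxE => <-; apply: eq_bigr => i _; rewrite vec_mxK !mxE.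
exists (2%:R^-1 *: (Z + Z^T)); first by rewrite /symm linearZ linearD /= trmxK addrC.
move=> j; rewrite pairingZ pairingD {2}/pairing Zy.
have -> : pairing Z j = y j.
  rewrite /pairing -mxtrace_tr trmx_mul (L_sym (basis_mem j)) mxtrace_mulC.
  exact: Zy.
have -> : y j + y j = 2%:R * y j by rewrite mulr_natl mulr2n.
by rewrite mulrA mulVf ?two_neq0 // mul1r.
Qed.

Lemma generic_pairing (q : {mpoly CC[m]}) : q != 0 ->
  generic (fun S => q.@[pairing S] != 0).
Proof.
move=> /meval_neq0[y qy]; have [S sS pS] := pairing_surj y.
apply: (@generic_polyfun n _ (fun S => q.@[pairing S])) => //.
  by apply: (fr_meval (@mxpolyfun_funring n)) => j; apply: mxpolyfun_pairing.
exists S => //; rewrite (_ : q.@[_] = q.@[y]) //; exact: meval_eq.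
Qed.

(** The polar space is cut out of all n^2 entries by [m] pairings and 'C(n, 2) symmetry equations.
    Since 'C(n.+1, 2) + 'C(n, 2) = n^2, the codimension hypothesis leaves a kernel of rank at least
    two. *)
Lemma polar_two : (m + 2 <= (n * n.+1) %/ 2)%N ->
  exists G1 G2, [/\ polar L G1, polar L G2 &
    forall a b, a *: G1 + b *: G2 = 0 -> a = 0 /\ b = 0].
Proof.
move=> codim.
pose I := {p : 'I_n * 'I_n | (p.1 < p.2)%N}.
pose C1 : 'M[CC]_(n * n, m) := \matrix_(i, j) mxvec (vbasis L)`_j 0 i.
pose C2 : 'M[CC]_(n * n, #|{: I}|) := \matrix_(i, j)
  mxvec (delta_mx (val (enum_val j)).1 (val (enum_val j)).2 -
         delta_mx (val (enum_val j)).2 (val (enum_val j)).1) 0 i.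
pose C := row_mx C1 C2.
have cI : #|{: I}| = 'C(n, 2) by rewrite card_sig card_ltn_ord2.
have r2 : (2 <= \rank (kermx C))%N.
  rewrite mxrank_ker.
  have rC : (\rank C <= m + 'C(n, 2))%N by rewrite -cI rank_leq_col.
  have : (m + 'C(n, 2) + 2 <= n * n)%N.
    have e1 : ((n * n.+1) %/ 2 = 'C(n.+1, 2))%N by rewrite bin2 mulnC divn2.
    have e2 : ('C(n.+1, 2) + 'C(n, 2) = n * n)%N.
      rewrite binS bin1 addnAC addnn -mul2n mul_bin_left bin1.
      by case: (n) => // k; rewrite subn1 /= -mulSnr.
    by rewrite addnAC -e2 -e1 leq_add2r.
  move=> le; rewrite leq_subRL; first by rewrite (leq_trans _ le) // leq_add2r.
  exact: rank_leq_row.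
pose Rb := row_base (kermx C).
have polG i : polar L (vec_mx (row i Rb)).
  have RC : row i Rb *m C = 0.
    by apply/sub_kermxP; apply: submx_trans (row_sub i Rb) _; rewrite eq_row_base.
  have dotG (A : 'M[CC]_n) : \tr (A *m (vec_mx (row i Rb))^T) =
      (row i Rb *m (mxvec A)^T) 0 0.
    rewrite -mxvec_dot vec_mxK mxE; apply: eq_bigr => l _.
    by rewrite [in RHS]mxE [X in _ = _ * X]mxE mulrC mxE.
  set G := vec_mx _ in dotG *.
  have [RC1 RC2] : row i Rb *m C1 = 0 /\ row i Rb *m C2 = 0.
    by apply: eq_row_mx; rewrite -mul_mx_row RC row_mx0.
  have sG : symm G.
    suff ltG (a b : 'I_n) : (a < b)%N -> G a b = G b a.
      apply/matrixP => a b; rewrite mxE; case: (ltngtP a b) => [/ltG ->|/ltG ->|/val_inj ->] //.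
    move=> ab; pose p : I := exist _ (a, b) ab.
    have E := congr1 (fun M : 'rV_ _ => M 0 (enum_rank p)) RC2; rewrite !mxE in E.
    apply/eqP; rewrite -subr_eq0.
    rewrite -(tr_delta_mx a b) -(tr_delta_mx b a) -raddfB -mulmxBl /= dotG mxE -[X in _ == X]E.
    by apply/eqP; apply: eq_bigr => l _; rewrite !mxE enum_rankK.
  apply/polarP; split=> // j; rewrite /pairing -{1}sG dotG.
  have E := congr1 (fun M : 'rV_ _ => M 0 j) RC1; rewrite !mxE in E.
  by rewrite mxE -[RHS]E; apply: eq_bigr => l _; rewrite !mxE.
pose i0 := Ordinal (ltnW r2); pose i1 := Ordinal r2.
exists (vec_mx (row i0 Rb)), (vec_mx (row i1 Rb)); split=> // a b.
move=> H; have E : a *: row i0 Rb + b *: row i1 Rb = 0.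
  by apply: (can_inj vec_mxK); rewrite linear0 linearD; apply: etrans H; congr (_ + _); apply: linearZ.
pose v : 'rV[CC]_(\rank (kermx C)) := a *: delta_mx 0 i0 + b *: delta_mx 0 i1.
have vR : v *m Rb = 0 by rewrite mulmxDl -!scalemxAl -!rowE E.
have v0 : v = 0.
  have /row_freeP[B RB] := row_base_free (kermx C).
  by rewrite -(mulmx1 v) -RB mulmxA vR mul0mx.
have := congr1 (fun M : 'rV_ _ => M 0 i0) v0; have := congr1 (fun M : 'rV_ _ => M 0 i1) v0.
by rewrite !mxE !eqxx /= !mulr1 !mulr0 add0r addr0 => -> ->.
Qed.

End Reciprocal.

Arguments lincomb {n} L x.
Arguments pairing {n} L X j.

(** * Finite sets, parameters to avoid, and secants met by a parabola *)

Lemma finite_has_card (T : eqType) (P : T -> Prop) (r : seq T) :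
  (forall x, P x -> x \in r) -> exists d, has_card P d.
Proof.
move=> Pr.
suff [s us sP] : exists2 s : seq T, uniq s & forall x, x \in s <-> P x /\ x \in r.
  exists (size s), s; split=> // x; rewrite sP; split=> [Px|[]] //.
  by split => //; apply: Pr.
elim: r {Pr} => [|a r [s us sP]].
  by exists [::] => // x; split=> // -[].
case: (classic (P a)) => Pa; last first.
  exists s => // x; rewrite sP inE; split=> -[Px]; first by move=> ->; rewrite orbT.
  by case/orP => [/eqP xa|//]; rewrite xa in Px.
exists (undup (a :: s)); first exact: undup_uniq.
move=> x; rewrite mem_undup !inE; split.
  by case/orP=> [/eqP ->|/sP[Px ->]]; rewrite ?eqxx ?orbT.
by case=> Px /orP[->//|xr]; apply/orP; right; apply/sP.
Qed.

Lemma closed_field_roots (F : closedFieldType) (p : {poly F}) : p != 0 ->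
  exists2 r : seq F, (size r < size p)%N & forall t, root p t -> t \in r.
Proof.
move=> p0; have [r pE] := closed_field_poly_normal p; exists r.
  by rewrite pE size_scale ?lead_coef_eq0 // size_prod_XsubC.
by move=> t; rewrite pE rootZ ?lead_coef_eq0 // root_prod_XsubC.
Qed.

Lemma avoid_roots (F : closedFieldType) (I : eqType) (r : seq I) (Bad : I -> F -> Prop) :
  (forall i, i \in r -> exists2 p : {poly F}, p != 0 & forall t, Bad i t -> root p t) ->
  exists2 p : {poly F}, p != 0 & forall i t, i \in r -> Bad i t -> root p t.
Proof.
elim: r => [|i r IH] H; first by exists 1; rewrite ?oner_neq0.
have [|p p0 pP] := H i; first by rewrite inE eqxx.
have [|q q0 qP] := IH; first by move=> j jr; apply: H; rewrite inE jr orbT.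
exists (p * q) => [|j t]; first by rewrite mulf_neq0.
rewrite inE rootM => /orP[/eqP ->|jr] B; first by rewrite pP.
by rewrite (qP j) // orbT.
Qed.

(* A line meets the parabola t |-> S0 + t G1 + t^2 G2 in at most two points:
   one of the 2x2 minors of (S0 + t G1 + t^2 G2 - X, D) is a nonzero polynomial. *)
Lemma line_meets_parabola n (S0 G1 G2 X D : 'M[CC]_n) : D != 0 ->
  (forall a b, a *: G1 + b *: G2 = 0 -> a = 0 /\ b = 0) ->
  exists2 p : {poly CC}, p != 0 &
    forall t, (exists s, S0 + t *: G1 + t ^+ 2 *: G2 = X + s *: D) -> root p t.
Proof.
move=> D0 freeG.
pose w c d (M : 'M[CC]_n) := M c.1 c.2 * D d.1 d.2 - M d.1 d.2 * D c.1 c.2.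
have [c [d w0]] : exists c d, (w c d G1 != 0) || (w c d G2 != 0).
  apply: NNPP => nex.
  have [d Dd] : exists d : 'I_n * 'I_n, D d.1 d.2 != 0.
    apply: NNPP => nd; case/eqP: D0; apply/matrixP => i j; rewrite mxE.
    by apply: NNPP => /eqP Dij; apply: nd; exists (i, j).
  have wz c : w c d G1 = 0 /\ w c d G2 = 0.
    by split; apply: NNPP => /eqP wn; apply: nex; exists c, d; rewrite wn ?orbT.
  (* If all minors vanish, [G1] and [G2] are both multiples of [D], so this combination of them is
     zero. *)
  have [] := freeG (G2 d.1 d.2) (- G1 d.1 d.2).
    apply/matrixP => i j; rewrite !mxE; apply: (mulIf Dd).
    have [/eqP] := wz (i, j); rewrite /w subr_eq0 /= => /eqP e1 /eqP.
    rewrite subr_eq0 /= => /eqP e2.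
    by rewrite mul0r mulrDl -!mulrA e1 e2; ring.
  move=> G2d /eqP; rewrite oppr_eq0 => /eqP G1d.
  have [|/eqP] := freeG 1 0; last by rewrite oner_eq0.
  apply/matrixP => i j; rewrite !mxE mul0r addr0 mul1r; apply: (mulIf Dd).
  have [/eqP] := wz (i, j); rewrite /w subr_eq0 /= => /eqP -> _.
  by rewrite G1d !mul0r.
exists ((w c d (S0 - X))%:P + (w c d G1)%:P * 'X + (w c d G2)%:P * 'X^2).
  apply: contraTneq w0 => p0; rewrite negb_or !negbK.
  have := congr1 (fun p : {poly CC} => p`_1) p0; have := congr1 (fun p : {poly CC} => p`_2) p0.
  rewrite !coefD !coefC !coefCM !coefXn !coefX /= !mulr0 !mulr1 !add0r !addr0 => -> ->.
  by rewrite eqxx.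
move=> t [s /matrixP E]; rewrite rootE !hornerD !hornerCM hornerC hornerX hornerXn /w !mxE.
have := E c.1 c.2; have := E d.1 d.2; rewrite !mxE => Ed Ec.
have -> : S0 c.1 c.2 = X c.1 c.2 + s * D c.1 c.2 - t * G1 c.1 c.2 - t ^+ 2 * G2 c.1 c.2.
  by rewrite -Ec; ring.
have -> : S0 d.1 d.2 = X d.1 d.2 + s * D d.1 d.2 - t * G1 d.1 d.2 - t ^+ 2 * G2 d.1 d.2.
  by rewrite -Ed; ring.
by apply/eqP; ring.
Qed.

(** * Generic fibers: finiteness, cardinality and secants *)

Section Fiber.
Variables (n : nat) (L : {vspace 'M[CC]_n}).
Hypothesis L_sym : forall K, K \in L -> symm K.
Let m := \dim L.
Implicit Types (X S G : 'M[CC]_n).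

Variable P : 'I_n -> 'I_n -> {poly {mpoly CC[m]}}.
Hypothesis P_neq0 : forall a b, P a b != 0.
Hypothesis P_rel : forall a b X, recip L X ->
  (map_poly (meval (pairing L X)) (P a b)).[X a b] = 0.
Variable q : {mpoly CC[m]}.
Hypothesis q_neq0 : q != 0.
Hypothesis q_rel : forall X, recip L X -> \det X = 0 -> q.@[pairing L X] = 0.

Definition fiber S X : Prop := recip L X /\ polar L (X - S).

Lemma fiberP S X : symm S ->
  fiber S X <-> recip L X /\ forall j, pairing L X j = pairing L S j.
Proof.
move=> sS; split=> -[rX].
  case/polarP => _ H; split=> // j; apply/eqP; rewrite -subr_eq0 -pairingB.
  by rewrite H.
move=> H; split=> //; apply/polarP; split=> [|j]; last by rewrite pairingB H subrr.
by rewrite /symm linearB /= (recip_symm L_sym rX) sS.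
Qed.

(** Over [pairing L S] no relation [P a b] drops in degree: entries of fiber points are roots of
    nonzero polynomials, and the resultant used for J keeps its formal degree. *)
Definition proper_at S : Prop := forall a b, (lead_coef (P a b)).@[pairing L S] != 0.

Lemma generic_proper_at : generic proper_at.
Proof.
apply: generic_all => a; apply: generic_all => b; apply: (generic_pairing L_sym).
by rewrite lead_coef_eq0 P_neq0.
Qed.

Lemma generic_det : generic (fun S => q.@[pairing L S] != 0).
Proof. exact: (generic_pairing L_sym q_neq0). Qed.

Lemma proper_at_poly_neq0 S a b : proper_at S -> map_poly (meval (pairing L S)) (P a b) != 0.
Proof.
move=> pS; apply: contraNneq (pS a b) => /(congr1 (fun p : {poly CC} => p`_(size (P a b)).-1)).
by rewrite coef_map coef0 => ->.
Qed.

(** The sum bounds the number of roots available to each entry. That the bound does not involve [S]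
    is what rules out generic fibers with more and more points. *)
Definition fiber_bound : nat :=
  #|{ffun 'I_n * 'I_n -> 'I_(\sum_a \sum_b size (P a b)).+1}|.

Lemma fiber_finite S : proper_at S ->
  exists2 r : seq 'M[CC]_n, (size r <= fiber_bound)%N &
    forall X, recip L X -> (forall j, pairing L X j = pairing L S j) -> X \in r.
Proof.
move=> pS; set E := (\sum_a \sum_b size (P a b))%N.
have /fin_all_exists[rs rsP] : forall c : 'I_n * 'I_n, exists r : seq CC,
   (size r <= E)%N /\ forall t, root (map_poly (meval (pairing L S)) (P c.1 c.2)) t -> t \in r.
  move=> [a b] /=; have [r sr rP] := closed_field_roots (proper_at_poly_neq0 a b pS).
  exists r; split=> //; apply: ltnW; apply: leq_trans sr _.
  apply: leq_trans (size_poly _ _) _.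
  by rewrite /E (bigD1 a) //= (bigD1 b) //= -addnA leq_addr.
exists [seq \matrix_(a, b) (rs (a, b))`_(f (a, b)) | f : {ffun 'I_n * 'I_n -> 'I_E.+1}].
  by rewrite size_map -cardE.
move=> X rX pX.
have XR c : X c.1 c.2 \in rs c.
  apply: (rsP c).2; rewrite rootE; apply/eqP; rewrite -[RHS](P_rel c.1 c.2 rX).
  by congr (_.[_]); apply: eq_map_poly => p; apply: meval_eq => j; rewrite pX.
have ltX c : (index (X c.1 c.2) (rs c) < E.+1)%N.
  by rewrite ltnS (leq_trans _ (rsP c).1) // ltnW // index_mem XR.
apply/mapP; exists [ffun c => Ordinal (ltX c)]; first by rewrite mem_enum.
by apply/matrixP => a b; rewrite mxE ffunE /= nth_index ?(XR (a, b)).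
Qed.

(** Row [i] of [x] holds the coordinates in [L] of the inverse of the i-th of [k] distinct fiber
    points; inverses are spelled out by adjugates to make the condition first-order. *)
Definition kfiber k S (x : 'M[CC]_(k, m)) : Prop :=
  (forall i, ~ (\det (lincomb L (x i)) = 0) /\ forall j,
    (\det (lincomb L (x i)))^-1 * pairing L (\adj (lincomb L (x i))) j = pairing L S j) /\
  forall i i', i != i' -> ~ forall j, x i j = x i' j.

Let termfun_row k o (i : 'I_k) a b :
  termfun (fun e => lincomb L (seq_mx k m o e i) a b).
Proof.
by apply: (fr_lincomb (termfun_funring _)) => j; apply: seq_mx_entry.
Qed.

Let termfun_half a b :
  termfun (fun e => (2%:R^-1 *: (seq_mx n n 0 e + (seq_mx n n 0 e)^T) : 'M[CC]_n) a b).
Proof.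
have fr := termfun_funring CC.
apply: (@fr_ext _ _ _ fr (fun e => 2%:R^-1 * (seq_mx n n 0 e a b + seq_mx n n 0 e b a))).
  by move=> e; rewrite !mxE.
apply: (fr_mul fr); first exact: fr_cst.
by apply: (fr_add fr); apply: seq_mx_entry.
Qed.

Lemma kfiber_dichotomy k :
  generic (fun S => exists x, @kfiber k S x) \/ generic (fun S => ~ exists x, @kfiber k S x).
Proof.
have fr := termfun_funring CC.
apply: generic_dichotomy; apply: definable_and; apply: definable_all => i.
  apply: definable_and.
    apply/definable_not/definable_eq; last exact: fr_cst.
    by apply: (fr_det fr).
  apply: definable_all => j; apply: definable_eq.
    apply: (fr_mul fr); first by apply: termfun_inv; apply: (fr_det fr).
    by apply: (fr_pairing fr) => a b; apply: (fr_adj fr).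
  exact: (fr_pairing fr).
apply: definable_all => i'; apply: definable_imp; apply: definable_not.
by apply: definable_all => j; apply: definable_eq; apply: seq_mx_entry.
Qed.

Lemma kfiber_seq k S (x : 'M[CC]_(k, m)) : symm S -> @kfiber k S x ->
  exists s : seq 'M[CC]_n, [/\ uniq s, size s = k & forall X, X \in s -> fiber S X].
Proof.
move=> sS [xS xn].
have xu i : lincomb L (x i) \in unitmx.
  by rewrite unitmxE unitfE; apply/eqP; apply: (xS i).1.
exists [seq invmx (lincomb L (x i)) | i <- enum 'I_k]; split.
- rewrite map_inj_uniq ?enum_uniq // => i i' /(can_inj (@invmxK _ _)) /lincomb_inj E.
  by apply: NNPP => /eqP ne; apply: (xn i i' ne).
- by rewrite size_map size_enum_ord.
move=> X /mapP[i _ ->]; apply/fiberP => //; split.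
  by apply: recip_inv => //; apply: lincomb_mem.
by move=> j; rewrite invmx_adj // pairingZ (xS i).2.
Qed.

Lemma fiber_lincomb S X : symm S -> q.@[pairing L S] != 0 -> fiber S X ->
  exists x : 'I_m -> CC, lincomb L x \in unitmx /\ X = invmx (lincomb L x).
Proof.
move=> sS qS /fiberP -/(_ sS) [rX pX].
have Xu : X \in unitmx.
  rewrite unitmxE unitfE; apply: contraNneq qS => dX; apply/eqP.
  by rewrite -[RHS](q_rel rX dX); apply: meval_eq => j; rewrite pX.
have [x xE] := lincombP (recip_invmx_mem rX Xu).
by exists x; rewrite -xE unitmx_inv invmxK.
Qed.

Lemma seq_kfiber S (s : seq 'M[CC]_n) : symm S -> q.@[pairing L S] != 0 ->
  uniq s -> (forall X, X \in s -> fiber S X) -> exists x, @kfiber (size s) S x.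
Proof.
move=> sS qS us sF.
have /fin_all_exists[x xE] : forall i : 'I_(size s), exists x : 'I_m -> CC,
    lincomb L x \in unitmx /\ s`_i = invmx (lincomb L x).
  by move=> i; apply: (fiber_lincomb sS qS); apply: sF; apply: mem_nth.
pose M : 'M[CC]_(size s, m) := \matrix_(i, j) x i j.
have ME i : lincomb L (M i) = lincomb L (x i).
  by apply: eq_bigr => j _; rewrite mxE.
exists M; split=> [i|i i' ne H].
  have [xu sE] := xE i; rewrite ME; split.
    by apply/eqP; rewrite -unitfE -unitmxE.
  move=> j; rewrite -pairingZ -invmx_adj // -sE.
  have /fiberP -/(_ sS) [_ ->//] : fiber S s`_i by apply: sF; apply: mem_nth.
case/negP: ne; rewrite -val_eqE -(nth_uniq 0 (ltn_ord i) (ltn_ord i') us).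
rewrite (xE i).2 (xE i').2 -!ME; apply/eqP; congr invmx.
by apply: eq_bigr => j _; rewrite H.
Qed.

(** The number [d] is the last [k] for which having [k] fiber points is generic; it exists because
    of [fiber_bound]. For [d.+1] the dichotomy turns failure to be generic into generic failure. *)
Lemma generic_fiber_card : exists d, generic (fun S => has_card (fiber S) d).
Proof.
have [d [gd ngd]] : exists d, generic (fun S => exists x, @kfiber d S x) /\
    ~ generic (fun S => exists x, @kfiber d.+1 S x).
  apply: NNPP => nex.
  have gall k : generic (fun S => exists x, @kfiber k S x).
    elim: k => [|k IH]; last first.
      by apply: NNPP => ng; apply: nex; exists k.
    apply: generic_sub generic_proper_at => S _ _; exists 0.
    by split; case.
  have [S sS [[x kx] pS]] := generic_ex (generic_and (gall fiber_bound.+1) generic_proper_at).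
  have [s [us ss sF]] := kfiber_seq sS kx.
  have [r sr rP] := fiber_finite pS.
  have : (size s <= size r)%N.
    apply: uniq_leq_size => // X /sF /fiberP -/(_ sS) [rX pX]; exact: rP.
  by rewrite ss leqNgt ltnS sr.
exists d; case: (kfiber_dichotomy d.+1) => // ngd'.
have G := generic_and (generic_and gd ngd') (generic_and generic_proper_at generic_det).
apply: generic_sub G => S sS [[[x kx] nk] [pS qS]].
have [r _ rP] := fiber_finite pS.
have [|d' [s [us sd sP]]] := @finite_has_card _ (fiber S) r.
  by move=> X /fiberP -/(_ sS) [rX pX]; apply: rP.
exists s; split=> //; apply/eqP; rewrite eqn_leq; apply/andP; split.
  rewrite leqNgt; apply/negP => lt; apply: nk.
  rewrite -(size_takel lt); apply: seq_kfiber => //; first exact: take_uniq.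
  by move=> X /mem_take /sP.
have [s' [us' <- sF']] := kfiber_seq sS kx.
by apply: uniq_leq_size => // X /sF' /sP.
Qed.

(** Rows 0 and 1 encode two distinct fiber points as in [kfiber]; row 2 carries, in column [j0], the
    parameter of [S] on their secant, so that one matrix holds all the variables. *)
Definition on_secant S (x : 'M[CC]_(3, m)) (j0 : 'I_m) : Prop :=
  let K i := lincomb L (x i) in
  ((forall i : 'I_2, ~ (\det (K (inord i)) = 0) /\ forall j,
    (\det (K (inord i)))^-1 * pairing L (\adj (K (inord i))) j = pairing L S j) /\
   ~ (forall j, x (inord 0) j = x (inord 1) j)) /\
  forall a b, S a b = (\det (K (inord 0)))^-1 * \adj (K (inord 0)) a b
    + x (inord 2) j0 * ((\det (K (inord 0)))^-1 * \adj (K (inord 0)) a b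
                      - (\det (K (inord 1)))^-1 * \adj (K (inord 1)) a b).

Lemma on_secant_dichotomy j0 :
  generic (fun S => exists x, on_secant S x j0) \/
  generic (fun S => ~ exists x, on_secant S x j0).
Proof.
have fr := termfun_funring CC.
have tinv o i a b : termfun (fun e => (\det (lincomb L (seq_mx 3 m o e i)))^-1 *
    \adj (lincomb L (seq_mx 3 m o e i)) a b).
  apply: (fr_mul fr); first by apply: termfun_inv; apply: (fr_det fr).
  exact: (fr_adj fr).
apply: generic_dichotomy; apply: definable_and; first apply: definable_and.
- apply: definable_all => i; apply: definable_and.
    apply/definable_not/definable_eq; last exact: fr_cst.
    by apply: (fr_det fr).
  apply: definable_all => j; apply: definable_eq.
    apply: (fr_mul fr); first by apply: termfun_inv; apply: (fr_det fr).
    by apply: (fr_pairing fr) => a b; apply: (fr_adj fr).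
  exact: (fr_pairing fr).
- apply: definable_not; apply: definable_all => j.
  by apply: definable_eq; apply: seq_mx_entry.
apply: definable_all => a; apply: definable_all => b; apply: definable_eq => //.
apply: (fr_add fr) => //; apply: (fr_mul fr); first exact: seq_mx_entry.
exact: (fr_sub fr).
Qed.

(** Otherwise [S] would generically lie on a secant. Along the parabola [St] the pairings, hence the
    fiber, stay constant, and its finitely many secants meet the parabola finitely often. A straight
    line would not do, since it could itself be a secant. *)
Lemma generic_not_on_secant G1 G2 (j0 : 'I_m) : polar L G1 -> polar L G2 ->
  (forall a b, a *: G1 + b *: G2 = 0 -> a = 0 /\ b = 0) ->
  generic (fun S => ~ exists X X' s,
    [/\ fiber S X, fiber S X', X != X' & S = X + s *: (X - X')]).
Proof.
move=> pol1 pol2 freeG.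
case: (on_secant_dichotomy j0) => [gs|ngs]; last first.
  apply: generic_sub (generic_and ngs generic_det) => S sS [nx qS] [X [X' [s [fX fX' ne SE]]]].
  apply: nx; have [x [xu xE]] := fiber_lincomb sS qS fX.
  have [x' [xu' xE']] := fiber_lincomb sS qS fX'.
  pose M : 'M[CC]_(3, m) :=
    \matrix_(i, j) (if i == inord 0 then x j else if i == inord 1 then x' j else s).
  have n01 : (inord 1 == inord 0 :> 'I_3) = false by rewrite -val_eqE /= !inordK.
  have n02 : (inord 2 == inord 0 :> 'I_3) = false by rewrite -val_eqE /= !inordK.
  have n12 : (inord 2 == inord 1 :> 'I_3) = false by rewrite -val_eqE /= !inordK.
  have M0 : lincomb L (M (inord 0)) = lincomb L x.
    by apply: eq_bigr => j _; rewrite mxE eqxx.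
  have M1 : lincomb L (M (inord 1)) = lincomb L x'.
    by apply: eq_bigr => j _; rewrite mxE n01 eqxx.
  have adjE Z y : lincomb L y \in unitmx -> Z = invmx (lincomb L y) ->
      Z = (\det (lincomb L y))^-1 *: \adj (lincomb L y).
    by move=> yu ->; rewrite invmx_adj.
  have good Z y : fiber S Z -> lincomb L y \in unitmx -> Z = invmx (lincomb L y) ->
    ~ (\det (lincomb L y) = 0) /\ forall j,
    (\det (lincomb L y))^-1 * pairing L (\adj (lincomb L y)) j = pairing L S j.
    move=> fZ yu ZE; split; first by apply/eqP; rewrite -unitfE -unitmxE.
    by move=> j; rewrite -pairingZ -(adjE Z) //; case/fiberP: fZ => // _ ->.
  exists M; split; first split.
  - case=> -[|[|//]] i2 /=; rewrite ?M0 ?M1; [exact: good fX xu xE|exact: good fX' xu' xE'].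
  - move=> H; case/eqP: ne; rewrite xE xE' -M0 -M1; congr invmx.
    by apply: eq_bigr => j _; rewrite H.
  have Ms : M (inord 2) j0 = s by rewrite mxE n02 n12.
  move=> a b; rewrite M0 M1 Ms {1}SE (adjE X x) // (adjE X' x') //.
  by rewrite !mxE.
exfalso.
have [f [[S0 s0 f0] fP]] := generic_and gs generic_proper_at.
have [_ pS0] := fP _ s0 f0.
have [r _ rP] := fiber_finite pS0.
have [/polarP[sG1 pG1] /polarP[sG2 pG2]] := (pol1, pol2).
pose St t := S0 + t *: G1 + t ^+ 2 *: G2.
have sSt t : symm (St t) by rewrite /symm /St !linearD !linearZ /= s0 sG1 sG2.
have pSt t j : pairing L (St t) j = pairing L S0 j.
  by rewrite /St !pairingD !pairingZ pG1 pG2 !mulr0 !addr0.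
pose u := mmap polyC (fun i => (mxvec S0 0 i)%:P + (mxvec G1 0 i)%:P * 'X
   + (mxvec G2 0 i)%:P * 'X^2) f.
have uSt t : u.[t] = mxeval f (St t).
  rewrite horner_mmap; apply: meval_eq => i; rewrite !hornerD !hornerCM hornerC hornerX hornerXn /St !linearD !linearZ /= !mxE.
  by rewrite [t * _]mulrC [t ^+ 2 * _]mulrC.
have u0 : u != 0.
  apply: contraNneq f0 => u0; have := uSt 0; rewrite u0 horner0 => ->.
  by rewrite /St expr0n /= !scale0r !addr0.
pose Bad (c : 'M[CC]_n * 'M[CC]_n) t := c.1 != c.2 /\ exists s, St t = c.1 + s *: (c.1 - c.2).
have [p p0 pP] : exists2 p : {poly CC}, p != 0 &
    forall c t, c \in [seq (X, X') | X <- r, X' <- r] -> Bad c t -> root p t.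
  apply: avoid_roots => -[X X'] _; case: (eqVneq X X') => [->|ne].
    by exists 1; rewrite ?oner_neq0 // => t []; rewrite eqxx.
  have [|p p0 pP] := @line_meets_parabola n S0 G1 G2 X (X - X') _ freeG.
    by rewrite subr_eq0.
  by exists p => // t [_ H]; apply: pP.
have [t] := closed_nonrootP _ (mulf_neq0 u0 p0).
rewrite rootM negb_or rootE uSt => /andP[ft pt].
have [[x [[xg xn] xE]] _] := fP _ (sSt t) ft.
have i2 (i : 'I_2) : lincomb L (x (inord i)) \in unitmx.
  by rewrite unitmxE unitfE; apply/eqP; apply: (xg i).1.
have inr (i : 'I_2) : invmx (lincomb L (x (inord i))) \in r.
  apply: rP; first by apply: recip_inv => //; apply: lincomb_mem.
  by move=> j; rewrite invmx_adj // pairingZ (xg i).2 pSt.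
case/negP: pt; pose X i := invmx (lincomb L (x (inord i))).
have [u0' u1'] := (i2 0, i2 1).
apply: (pP (X 0%N, X 1%N)).
  by apply: allpairs_f; [exact: (inr 0)|exact: (inr 1)].
split=> /=; last first.
  exists (x (inord 2) j0); apply/matrixP => a b; rewrite xE /X.
  by rewrite !invmx_adj // !mxE.
apply/eqP => /(can_inj (@invmxK _ _)) /lincomb_inj; exact: xn.
Qed.

End Fiber.

(* R is the resultant of Ft and Gt with respect to the formal degree e of Ft, which
   survives the specializations that lower the degree of Gt. *)
Lemma sylvester_elimination (A : comNzRingType) (F : closedFieldType) X
    (ev : X -> {rmorphism A -> F}) (Ft Gt : {poly A}) e : (size Ft <= e.+1)%N ->
  exists R : A,
    (forall x t, root (map_poly (ev x) Ft) t -> root (map_poly (ev x) Gt) t -> ev x R = 0) /\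
    (forall x, size (map_poly (ev x) Ft) = e.+1 ->
       (forall t, root (map_poly (ev x) Ft) t -> ~~ root (map_poly (ev x) Gt) t) ->
       ev x R != 0).
Proof.
(* The successor keeps the matrix nonempty even when [Gt] is zero and [e] is 0, so that the vector
   of powers of [t] has its entry 1. *)
move=> sF; have [g gE] : exists g, g = (size Gt).+1 by exists (size Gt).+1.
have g0 : (0 < g + e)%N by rewrite gE.
pose M : 'M[A]_(g + e) := col_mx (\matrix_(i < g, l < g + e) ('X^i * Ft)`_l)
                                 (\matrix_(i < e, l < g + e) ('X^i * Gt)`_l).
exists (\det M).
pose U x : 'M[F]_(g, g + e) := \matrix_(i, l) ('X^i * map_poly (ev x) Ft)`_l.
pose V x : 'M[F]_(e, g + e) := \matrix_(i, l) ('X^i * map_poly (ev x) Gt)`_l.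
have MUV x : map_mx (ev x) M = col_mx (U x) (V x).
  rewrite map_col_mx; congr col_mx; apply/matrixP => i l;
  by rewrite !mxE -coef_map rmorphM /= map_polyXn.
have szU x (i : 'I_g) : (size ('X^i * map_poly (ev x) Ft)%R <= g + e)%N.
  apply: leq_trans (size_polyMleq _ _) _; rewrite size_polyXn /=.
  have := leq_trans (size_poly _ _ : size (map_poly (ev x) Ft) <= _)%N sF.
  by move/(leq_add (leqnn i))/leq_trans; apply; rewrite addnS -addSn leq_add2r.
have szV x (i : 'I_e) : (size ('X^i * map_poly (ev x) Gt)%R <= g + e)%N.
  apply: leq_trans (size_polyMleq _ _) _; rewrite size_polyXn /= addnC.
  by apply: leq_add; apply: ltnW => //; rewrite gE ltnS size_poly.
split=> x => [t rF rG|szF cop].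
  rewrite -det_map_mx MUV; apply: NNPP => /eqP d0.
  have Mu : col_mx (U x) (V x) \in unitmx by rewrite unitmxE unitfE.
  pose c : 'cV[F]_(g + e) := \col_l t ^+ l.
  have ev0 (p : {poly F}) : (size p <= g + e)%N -> root p t ->
      \sum_(l < g + e) p`_l * t ^+ l = 0.
    by move=> sp /rootP pt; rewrite -(horner_coef_wide _ sp).
  have Uc : U x *m c = 0.
    apply/matrixP => i j; rewrite mxE [RHS]mxE.
    have rt : root ('X^i * map_poly (ev x) Ft) t by rewrite rootM rF orbT.
    rewrite -[RHS](ev0 _ (szU x i) rt).
    by apply: eq_bigr => l _; rewrite [U x i l]mxE [c l j]mxE.
  have Vc : V x *m c = 0.
    apply/matrixP => i j; rewrite mxE [RHS]mxE.
    have rt : root ('X^i * map_poly (ev x) Gt) t by rewrite rootM rG orbT.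
    rewrite -[RHS](ev0 _ (szV x i) rt).
    by apply: eq_bigr => l _; rewrite [V x i l]mxE [c l j]mxE.
  have Mc : col_mx (U x) (V x) *m c = 0 by rewrite mul_col_mx Uc Vc col_mx0.
  have := mulKmx Mu c; rewrite Mc mulmx0 => /matrixP/(_ (Ordinal g0) 0).
  by rewrite !mxE expr0 => /esym/eqP; rewrite oner_eq0.
rewrite -det_map_mx MUV; apply/negP => /det0P[w w0 wM].
set Fx := map_poly (ev x) Ft in szF cop szU *; set Gx := map_poly (ev x) Gt in cop szV *.
rewrite -(hsubmxK w) mul_row_col in wM.
set w1 := lsubmx w in wM *; set w2 := rsubmx w in wM.
have rE d (v : 'rV[F]_d) (p : {poly F}) l :
    (rVpoly v * p)`_l = \sum_i v 0 i * ('X^i * p)`_l.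
  rewrite /rVpoly poly_def big_distrl coef_sum; apply: eq_bigr => i _ /=.
  by rewrite valK -scalerAl coefZ.
have F0 : Fx != 0 by rewrite -size_poly_eq0 szF.
(* A left kernel vector is a pair of cofactors. By coprimality [Fx], of degree [e], divides the
   second, which has smaller degree and so vanishes. *)
have E : rVpoly w1 * Fx + rVpoly w2 * Gx = 0.
  apply/polyP => l; rewrite coef0 coefD !rE.
  case: (ltnP l (g + e)) => ll.
    have Z : (w1 *m U x) 0 (Ordinal ll) + (w2 *m V x) 0 (Ordinal ll) = 0.
      by have := congr1 (fun B : 'rV_ _ => B 0 (Ordinal ll)) wM; rewrite mxE [RHS]mxE.
    rewrite -[RHS]Z; congr (_ + _); rewrite [RHS]mxE; apply: eq_bigr => i _.
      by rewrite [U x i _]mxE.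
    by rewrite [V x i _]mxE.
  rewrite !big1 ?addr0 // => i _; rewrite nth_default ?mulr0 //.
    exact: leq_trans (szV x i) ll.
  exact: leq_trans (szU x i) ll.
have copFG : coprimep Fx Gx.
  apply/Pdiv.ClosedField.coprimepP => t; rewrite -?rootE => rt; exact: cop.
have F2 : Fx %| rVpoly w2.
  rewrite -(Gauss_dvdpl _ copFG); apply/dvdpP; exists (- rVpoly w1).
  by apply/eqP; rewrite mulNr -addr_eq0 addrC E.
have w20 : rVpoly w2 = 0.
  apply: NNPP => /eqP ne; have := dvdp_leq ne F2.
  by rewrite szF leqNgt ltnS size_poly.
have w10 : rVpoly w1 = 0.
  by move/eqP: E; rewrite w20 mul0r addr0 mulf_eq0 (negPf F0) orbF => /eqP.
case/eqP: w0; rewrite -(hsubmxK w) -/w1 -/w2 -(rVpolyK w1) -(rVpolyK w2) w10 w20.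
by rewrite !linear0 row_mx0.
Qed.

(** * Lines spanned by two vectors, and the lines of J *)

Lemma free2P (K : fieldType) (V : vectType K) (u v : V) :
  free [:: u; v] <-> forall a b, a *: u + b *: v = 0 -> a = 0 /\ b = 0.
Proof.
split=> [/(@freeP _ _ 2 [tuple u; v]) fr a b E|H].
  have := fr (fun i : 'I_2 => if i == 0 then a else b).
  rewrite !big_ord_recl big_ord0 /= addr0 => /(_ E) fr'.
  by have := fr' 0; have := fr' 1; rewrite /= => -> ->.
apply/(@freeP _ _ 2 [tuple u; v]) => k; rewrite !big_ord_recl big_ord0 /= addr0 => /H[k0 k1].
case=> -[|[|//]] i2; [rewrite -[RHS]k0|rewrite -[RHS]k1]; congr k; exact: val_inj.
Qed.

Lemma mem_lineP (K : fieldType) (V : vectType K) (u v w : V) :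
  reflect (exists a b, w = a *: u + b *: v) (w \in <[u]> + <[v]>)%VS.
Proof.
apply: (iffP memv_addP) => [[u' /vlineP[a ->] [v' /vlineP[b ->] ->]]|[a [b ->]]].
  by exists a, b.
by exists (a *: u); [rewrite memvZ ?memv_line|exists (b *: v); rewrite ?memvZ ?memv_line].
Qed.

Lemma dim_line2 (K : fieldType) (V : vectType K) (u v : V) :
  free [:: u; v] -> \dim (<[u]> + <[v]>) = 2%N.
Proof. by move/eqP; rewrite span_cons span_seq1. Qed.

Lemma line_span (K : fieldType) (V : vectType K) (W : {vspace V}) u v :
  \dim W = 2%N -> u \in W -> v \in W -> free [:: u; v] -> (<[u]> + <[v]>)%VS = W.
Proof.
move=> dW uW vW /dim_line2 duv; apply/eqP; rewrite eqEdim dW duv leqnn andbT.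
by rewrite subv_add -!memvE uW.
Qed.

Section Lines.
Variables (n : nat) (L : {vspace 'M[CC]_n}).
Hypothesis L_sym : forall K, K \in L -> symm K.
Let m := \dim L.
Implicit Types (X S G u v : 'M[CC]_n) (W : {vspace 'M[CC]_n}).

Variable P : 'I_n -> 'I_n -> {poly {mpoly CC[m]}}.
Hypothesis P_neq0 : forall a b, P a b != 0.
Hypothesis P_rel : forall a b X, recip L X ->
  (map_poly (meval (pairing L X)) (P a b)).[X a b] = 0.

Let plc (uv : 'M[CC]_n * 'M[CC]_n) i : CC := plucker uv.1 uv.2 0 i.

Let frp : funring (polyfun plc) := polyfun_funring plc.

(* The vectors obtained by contracting the bivector u /\ v with a matrix entry, and
   with a pairing. *)
Definition entry_contr (uv : 'M[CC]_n * 'M[CC]_n) a b : 'M[CC]_n :=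
  uv.2 a b *: uv.1 - uv.1 a b *: uv.2.

Definition pairing_contr (uv : 'M[CC]_n * 'M[CC]_n) (k : 'I_m) : 'M[CC]_n :=
  pairing L uv.1 k *: uv.2 - pairing L uv.2 k *: uv.1.

Lemma polyfun_entry_contr a b c d : polyfun plc (fun uv => entry_contr uv a b c d).
Proof.
apply: (fr_ext frp) (polyfun_var plc (mxvec_index (mxvec_index c d) (mxvec_index a b))).
move=> uv; rewrite /plc /plucker mxvecE !mxE !big_ord1 !mxE !mxvecE.
by rewrite mulrC [in X in _ - X]mulrC.
Qed.

Lemma polyfun_pairing_contr k c d : polyfun plc (fun uv => pairing_contr uv k c d).
Proof.
apply: (@fr_ext _ _ _ frp (fun uv => pairing L (entry_contr uv c d) k)).
  by move=> uv; rewrite pairingB !pairingZ !mxE mulrC [in X in _ - X]mulrC.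
by apply: (fr_pairing frp) => a b; apply: polyfun_entry_contr.
Qed.

Lemma Jvar_vanish (f : 'M[CC]_n * 'M[CC]_n -> CC) : polyfun plc f ->
  (forall u v, free [:: u; v] -> J0 L (<[u]> + <[v]>)%VS -> f (u, v) = 0) ->
  forall W u v, Jvar L W -> free [:: u; v] -> (<[u]> + <[v]>)%VS = W -> f (u, v) = 0.
Proof.
move=> [p E] H W u v [_ JW] fr uvW; rewrite E; apply: (JW p) uvW => //.
by move=> u' v' fr' /(H _ _ fr'); rewrite E.
Qed.

(** On a line that meets the polar space the vectors of pairings span at most one dimension, so a
    point where one contracted pairing cancels has all pairings zero. *)
Lemma J0_pairing_contr u v j k : J0 L (<[u]> + <[v]>)%VS ->
  pairing L (pairing_contr (u, v) j) k = 0.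
Proof.
case=> _ [Sg [G [_ /polarP[_ pG] /free2P fr _ /mem_lineP[x [y GE]]]]].
rewrite pairingB !pairingZ /=.
have eq i : x * pairing L u i + y * pairing L v i = 0.
  by rewrite -!pairingZ -pairingD -GE pG.
case: (eqVneq x 0) => [x0|x0].
  case: (eqVneq y 0) => [y0|y0].
    have [] := fr 0 1; last by move=> _ /eqP; rewrite oner_eq0.
    by rewrite GE x0 y0 !scale0r addr0 scaler0 addr0.
  have e i : pairing L v i = 0.
    by apply: (mulfI y0); rewrite mulr0 -[RHS](eq i) x0 mul0r add0r.
  by rewrite !e mulr0 mul0r subrr.
apply: (mulfI x0); rewrite mulr0.
have e i : x * pairing L u i = - (y * pairing L v i) by apply/eqP; rewrite -addr_eq0 eq.
rewrite mulrBr [x * (_ * pairing L v k)]mulrA [x * (_ * pairing L u k)]mulrCA !e.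
by ring.
Qed.

(** Adding multiples of [G] fixes the pairings but moves a nonzero entry of [G] through all values,
    among them a non-root of the specialized relation. *)
Lemma generic_not_recip G : polar L G -> G != 0 -> generic (fun S => ~ recip L S).
Proof.
move=> /polarP[sG pG] G0.
have [a [b Gab]] : exists a b, G a b != 0.
  apply: NNPP => nex; case/eqP: G0; apply/matrixP => a b; rewrite mxE.
  by apply: NNPP => /eqP Gab; apply: nex; exists a, b.
apply: (@generic_polyfun n _ (fun S => (map_poly (meval (pairing L S)) (P a b)).[S a b])).
- apply: (fr_horner (@mxpolyfun_funring n)); last exact: mxpolyfun_entry.
  by move=> j; apply: mxpolyfun_pairing.
- have [S sS pS] := generic_ex (generic_proper_at L_sym P_neq0).
  have [t] := closed_nonrootP _ (proper_at_poly_neq0 a b pS); rewrite rootE => nt.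
  exists (S + ((t - S a b) / G a b) *: G).
    by rewrite /symm linearD linearZ /= sS sG.
  rewrite !mxE divfK // addrCA subrr addr0.
  rewrite (_ : map_poly _ _ = map_poly (meval (pairing L S)) (P a b)) //.
  apply: eq_map_poly => p; apply: meval_eq => j.
  by rewrite pairingD pairingZ pG mulr0 addr0.
by move=> S _ /eqP nS rS; apply/nS/P_rel.
Qed.

(** Given [g] for the tail and [f] for the head, [g + c f] serves both for all but finitely many
    [c]. *)
Lemma separating_polyfun (r : seq 'M[CC]_n) : (forall X, X \in r -> ~ recip L X) ->
  exists f, [/\ mxpolyfun f, forall X, recip L X -> f X = 0 & forall X, X \in r -> f X != 0].
Proof.
have frn := @mxpolyfun_funring n.
elim: r => [|X r IH] H.
  by exists (fun=> 0); split=> //; apply: fr_cst.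
have [|g [pg gP gr]] := IH; first by move=> Y Yr; apply: H; rewrite inE Yr orbT.
have [|f [pf fP fX]] := @notin_zclosure _ _ X (_ : ~ recip L X).
  by apply: H; rewrite inE eqxx.
have [p p0 pP] : exists2 p : {poly CC}, p != 0 &
    forall Y c, Y \in X :: r -> g Y + c * f Y = 0 -> root p c.
  apply: avoid_roots => Y Yr; exists ((g Y)%:P + (f Y)%:P * 'X).
    apply/eqP => p0; move: Yr; rewrite inE => /orP[/eqP YX|/gr/eqP gY].
      have := congr1 (fun p : {poly CC} => p`_1) p0.
      rewrite coefD coefC coefCM coefX coef0 /= mulr1 add0r YX => f0.
      by rewrite f0 eqxx in fX.
    have := congr1 (fun p : {poly CC} => p`_0) p0.
    by rewrite coefD coefC coefCM coefX coef0 /= mulr0 addr0.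
  by move=> t E; rewrite rootE hornerD hornerCM hornerC hornerX mulrC E.
have [c nc] := closed_nonrootP _ p0.
exists (fun Y => g Y + c * f Y); split.
- by apply: (fr_add frn) => //; apply: (fr_mul frn) => //; apply: fr_cst.
- by move=> Y rY; rewrite gP // (zclosureP pf fP rY) mulr0 addr0.
by move=> Y Yr; apply: contraNneq nc => /(pP _ _ Yr).
Qed.

(* Otherwise let R be the resultant in t of the relation P_ab and of a function f
   vanishing on the reciprocal variety, both taken at s + t g, where s and g are
   contractions of u /\ v; c makes s + t g a point of S + CC G when (u, v) = (S, G).
   Then D R is a polynomial in the Pluecker coordinates which vanishes on J0, and
   not at (S, G) if f is nonzero at the finitely many points of S + CC G where P_ab
   vanishes. *)
Lemma Jvar_meets_recip S G k : symm S -> proper_at P S -> pairing L S k != 0 ->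
  polar L G -> free [:: S; G] -> Jvar L (<[S]> + <[G]>)%VS ->
  exists t, recip L (S + t *: G).
Proof.
move=> sS pS kap0 /polarP[sG pG] fr JW.
set kap := pairing L S k in kap0.
have [a [b Gab]] : exists a b, G a b != 0.
  apply: NNPP => nex; have /free2P/(_ 0 1)[] := fr; last first.
    by move=> _ /eqP; rewrite oner_eq0.
  apply/matrixP => a b; rewrite !mxE mul0r add0r mul1r.
  by apply: NNPP => /eqP Gab; apply: nex; exists a, b.
apply: NNPP => nt; pose c := (G a b)^-1.
pose s uv := c *: entry_contr uv a b; pose g uv := c *: pairing_contr uv k.
have ps i j : polyfun plc (fun uv => s uv i j).
  apply: (fr_ext frp) (fr_mul frp (fr_cst frp c) (polyfun_entry_contr a b i j)) => uv.
  by rewrite /s [RHS]mxE.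
have pg i j : polyfun plc (fun uv => g uv i j).
  apply: (fr_ext frp) (fr_mul frp (fr_cst frp c) (polyfun_pairing_contr k i j)) => uv.
  by rewrite /g [RHS]mxE.
pose e := (size (P a b)).-1.
have eS : e.+1 = size (P a b) by rewrite /e prednK // size_poly_gt0.
(* These are the coefficients in t of [P a b] at s + t g: the entry (a, b) of [s] is zero by
   construction, and on J0 the pairings of [g] vanish. *)
pose fco uv (i : nat) := ((P a b)`_i).@[pairing L (s uv)] * (g uv a b) ^+ i.
have /fin_all_exists[h hE] : forall i : 'I_e.+1, exists h : {mpoly CC[_]},
    forall uv, fco uv i = h.@[plc uv].
  move=> i; apply: (fr_mul frp); last by apply: (fr_exp frp); apply: pg.
  apply: (@fr_meval _ _ _ frp m (P a b)`_i (fun uv => pairing L (s uv))) => j.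
  by apply: (@fr_pairing n L _ _ frp s j) => a' b'; apply: ps.
pose Ft := \poly_(i < e.+1) h (inord i).
have FtE uv : map_poly (meval (plc uv)) Ft = \poly_(i < e.+1) fco uv i.
  apply/polyP => i; rewrite coef_map !coef_poly; case: ifP => ie; last exact: meval0.
  by have := hE (inord i) uv; rewrite inordK // => ->.
have FtR uv t : (map_poly (meval (plc uv)) Ft).[t] =
    (map_poly (meval (pairing L (s uv))) (P a b)).[g uv a b * t].
  rewrite FtE horner_poly (@horner_coef_wide _ e.+1); last by rewrite eS size_poly.
  by apply: eq_bigr => i _; rewrite coef_map /fco exprMn mulrA.
have sSG : s (S, G) = S - (c * S a b) *: G.
  by rewrite /s /entry_contr /= scalerBr !scalerA mulVf // scale1r.
have gSG : g (S, G) = (c * kap) *: G.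
  by rewrite /g /pairing_contr /= pG scale0r subr0 scalerA.
have pairs j : pairing L (s (S, G)) j = pairing L S j.
  by rewrite sSG pairingB pairingZ pG mulr0 subr0.
have szF : size (map_poly (meval (plc (S, G))) Ft) = e.+1.
  rewrite FtE size_poly_eq // /fco mulf_neq0 //.
    rewrite (_ : _.@[_] = (lead_coef (P a b)).@[pairing L S]) ?pS //.
    exact: meval_eq.
  by rewrite expf_neq0 // gSG mxE mulrAC mulVf // mul1r.
have F0 : map_poly (meval (plc (S, G))) Ft != 0 by rewrite -size_poly_eq0 szF.
have [r _ rP] := closed_field_roots F0.
have [|f [pf fP fr']] := @separating_polyfun [seq s (S, G) + t *: g (S, G) | t <- r].
  move=> X /mapP[t _ ->] rX; apply: nt; exists (t * (c * kap) - c * S a b).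
  by move: rX; rewrite sSG gSG scalerA scalerBl -addrA [- _ + _]addrC.
have [pf' fE] := pf.
pose ev uv : {rmorphism {poly {mpoly CC[n * n * (n * n)]}} -> {poly CC}} :=
  map_poly (meval (plc uv)).
have frt : funring (representable ev).
  apply: representable_funring => q; exists (map_poly (@mpolyC _ _) q) => uv.
  by apply/polyP => i; rewrite /ev /= !coef_map /= mevalC.
have cstt (q : 'M[CC]_n * 'M[CC]_n -> CC) : polyfun plc q -> representable ev (fun uv => (q uv)%:P).
  by move=> [q' qE]; exists q'%:P => uv; rewrite /ev /= map_polyC qE.
have [Gt GtE] : representable ev (fun uv =>
    mmap polyC (fun i => (mxvec (s uv) 0 i)%:P + (mxvec (g uv) 0 i)%:P * 'X) pf').
  apply: (fr_mmap frt polyC pf' (h := fun i uv =>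
    (mxvec (s uv) 0 i)%:P + (mxvec (g uv) 0 i)%:P * 'X)) => i.
  case/mxvec_indexP: i => i j; apply: (fr_add frt).
    by apply: cstt; apply: (fr_ext frp) (ps i j) => uv; rewrite mxvecE.
  apply: (fr_mul frt); last exact: fr_cst.
  by apply: cstt; apply: (fr_ext frp) (pg i j) => uv; rewrite mxvecE.
have GtR uv t : (map_poly (meval (plc uv)) Gt).[t] = f (s uv + t *: g uv).
  rewrite -[map_poly _ _]GtE horner_mmap fE /=; apply: meval_eq => i.
  rewrite hornerD hornerCM !hornerC hornerX; case/mxvec_indexP: i => i j.
  by move: (s uv) (g uv) => M N; rewrite !mxvecE !mxE mulrC.
have [|R [R0 Rn]] := @sylvester_elimination _ _ _
  (fun uv => meval (plc uv) : {rmorphism _ -> _}) Ft Gt e; first exact: size_poly.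
(* [D] is the determinant expressing the two contractions in terms of [u] and [v]; as a factor it
   disposes of the lines on which they are dependent. *)
pose D uv := pairing L (entry_contr uv a b) k.
have pD : polyfun plc D by apply: (fr_pairing frp) => i j; apply: polyfun_entry_contr.
have DR : polyfun plc (fun uv => D uv * R.@[plc uv]).
  by apply: (fr_mul frp) => //; exists R.
have : D (S, G) * R.@[plc (S, G)] != 0.
  rewrite mulf_neq0 //.
    by rewrite /D pairingB !pairingZ /= pG mulr0 subr0 mulf_neq0.
  apply: Rn => // t rt; rewrite rootE GtR; apply: fr'.
  by apply/mapP; exists t => //; apply: rP.
case/eqP; apply: (Jvar_vanish DR) JW fr (erefl _) => u v fruv J.
case: (eqVneq (D (u, v)) 0) => [->|D0]; first by rewrite mul0r.
have gp j : pairing L (g (u, v)) j = 0 by rewrite pairingZ J0_pairing_contr ?mulr0.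
have [_ [Sg [Gm [rSg /polarP[_ pGm] frSG SgW GmW]]]] := J.
have DE : D (u, v) = v a b * pairing L u k - u a b * pairing L v k.
  by rewrite /D pairingB !pairingZ.
have Sgk : pairing L Sg k != 0.
  apply: contraNneq D0 => Sgk.
  have W0 w : w \in (<[u]> + <[v]>)%VS -> pairing L w k = 0.
    rewrite -(line_span (dim_line2 fruv) SgW GmW frSG) => /mem_lineP[x [y ->]].
    by rewrite pairingD !pairingZ Sgk pGm !mulr0 addr0.
  by rewrite DE !W0 ?mulr0 ?subrr //; apply/mem_lineP;
    [exists 0, 1|exists 1, 0]; rewrite ?scale1r ?scale0r ?add0r ?addr0.
(* Cramer's rule: where [D] is nonzero, the entry (a, b) and the k-th pairing are coordinates on the
   line. *)
have SgE : D (u, v) *: Sg =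
    pairing L Sg k *: entry_contr (u, v) a b + Sg a b *: pairing_contr (u, v) k.
  have /mem_lineP[x [y ->]] := SgW.
  rewrite DE pairingD !pairingZ /entry_contr /pairing_contr /=.
  move: (pairing L u k) (pairing L v k) => pu pv.
  by apply/matrixP => i j; rewrite !mxE; ring.
pose t := Sg a b / pairing L Sg k.
have XE : s (u, v) + t *: g (u, v) = (c * D (u, v) / pairing L Sg k) *: Sg.
  rewrite /s /g; move: (D (u, v)) (entry_contr (u, v) a b) (pairing_contr (u, v) k) SgE.
  move=> d E1 E2 SgE.
  transitivity ((c / pairing L Sg k) *: (d *: Sg)); last by rewrite scalerA mulrAC.
  rewrite SgE scalerDr !scalerA divfK //; congr (_ + _ *: _).
  by rewrite /t mulrC mulrA mulrAC.
have rX : recip L (s (u, v) + t *: g (u, v)).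
  by rewrite XE; apply: recip_scale => //; rewrite !mulf_neq0 ?invr_eq0.
have sab : s (u, v) a b = 0 by rewrite !mxE /= [v a b * _]mulrC subrr mulr0.
have addE (M N : 'M[CC]_n) : M a b = 0 -> N a b * t = (M + t *: N) a b.
  by move=> M0; rewrite !mxE M0 add0r mulrC.
have addp (M N : 'M[CC]_n) j : pairing L N j = 0 -> pairing L M j = pairing L (M + t *: N) j.
  by move=> N0; rewrite pairingD pairingZ N0 mulr0 addr0.
have FtR0 : (map_poly (meval (plc (u, v))) Ft).[t] = 0.
  rewrite FtR (addE _ _ sab).
  rewrite (_ : map_poly _ _ = map_poly (meval (pairing L (s (u, v) + t *: g (u, v)))) (P a b)).
    exact: P_rel.
  by apply: eq_map_poly => q; apply: meval_eq => j; apply: addp; apply: gp.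
by rewrite (R0 _ t) ?mulr0 // rootE; apply/eqP => //; rewrite GtR fP.
Qed.

(** Contracting [W] with the k-th pairing gives its point [G] in the polar space, independent of [S]
    because the pairing of [S] is nonzero. As [S] is not in the reciprocal variety, the point found
    on S + t G has t nonzero and so spans [W] with [S]. *)
Lemma Jvar_fiber S W k : symm S -> proper_at P S -> pairing L S k != 0 -> ~ recip L S ->
  Jvar L W -> S \in W -> exists2 X, fiber L S X & (<[S]> + <[X]>)%VS = W.
Proof.
move=> sS pS kS nS JW SW; have [[dW symW] _] := JW.
have [v vW vS] : exists2 v, v \in W & v \notin <[S]>%VS.
  apply/subvPn; apply/negP => /dimvS; rewrite dW dim_vline.
  by case: (S != 0).
have S0 : S != 0.
  by apply: contraNneq kS => ->; rewrite -(scale0r 0) pairingZ mul0r.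
have frSv : free [:: S; v].
  apply/free2P => x y E; case: (eqVneq y 0) => [y0|y0].
    split=> //; move: E; rewrite y0 scale0r addr0 => /eqP.
    by rewrite scaler_eq0 (negPf S0) orbF => /eqP.
  case/negP: vS; apply/vlineP; exists (- (x / y)); apply: (scalerI y0).
  by rewrite scalerA mulrN mulrCA mulfV // mulr1 scaleNr; apply/eqP; rewrite -addr_eq0 addrC E.
have SvW := line_span dW SW vW frSv.
pose G := pairing_contr (S, v) k.
have pG : polar L G.
  apply/polarP; split.
    by rewrite /symm /G /pairing_contr linearB !linearZ /= sS symW.
  move=> j; have pf : polyfun plc (fun uv => pairing L (pairing_contr uv k) j).
    by apply: (fr_pairing frp) => a b; apply: polyfun_pairing_contr.
  apply: (Jvar_vanish pf) JW frSv SvW => u w _; exact: J0_pairing_contr.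
have frSG : free [:: S; G].
  apply/free2P => x y E.
  have : (x - y * pairing L v k) *: S + (y * pairing L S k) *: v = 0.
    by rewrite -[RHS]E /G /pairing_contr /= scalerBr !scalerA scalerBl addrAC -addrA.
  case/((free2P _ _).1 frSv) => + /eqP; rewrite mulf_eq0 (negPf kS) orbF => x0 /eqP y0.
  by move: x0; rewrite y0 mul0r subr0.
have GW : G \in W by rewrite rpredB // memvZ.
have SGW := line_span dW SW GW frSG.
clearbody G.
have [|t rt] := Jvar_meets_recip sS pS kS pG frSG; first by rewrite SGW.
have t0 : t != 0 by apply: contra_not_neq nS => t0; rewrite t0 scale0r addr0 in rt.
exists (S + t *: G).
  have /polarP[sG zG] := pG; split=> //; apply/polarP; rewrite addrC addKr.
  by split=> [|j]; [rewrite /symm linearZ /= sG|rewrite pairingZ zG mulr0].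
apply: line_span => //; first by rewrite rpredD // memvZ.
apply/free2P => x y; rewrite scalerDr scalerA addrA -scalerDl.
case/((free2P _ _).1 frSG) => + /eqP; rewrite mulf_eq0 (negPf t0) orbF => xy /eqP y0.
by move: xy; rewrite y0 addr0.
Qed.

(** The points [X] and [X - S] show that the line is in J0. Equal nonzero pairings leave [X = S] as
    the only possible dependence, and [~ recip L S] excludes it. *)
Lemma fiber_Jvar S X k : symm S -> pairing L S k != 0 -> ~ recip L S -> fiber L S X ->
  Jvar L (<[S]> + <[X]>)%VS.
Proof.
move=> sS kS nS fX; have [rX polX] := fX.
have [_ pX] := (fiberP L_sym X sS).1 fX; have sX := recip_symm L_sym rX.
have indep x y : x *: S + y *: X = 0 -> x = 0 /\ y = 0.
  move=> E; have /eqP : (x + y) * pairing L S k = 0.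
    by rewrite mulrDl -{2}pX -!pairingZ -pairingD E -(scale0r 0) pairingZ mul0r.
  rewrite mulf_eq0 (negPf kS) orbF addr_eq0 => /eqP xy.
  have : y *: (X - S) = 0 by rewrite scalerBr -scaleNr -xy addrC.
  move/eqP; rewrite scaler_eq0 => /orP[/eqP y0|]; first by rewrite xy y0 oppr0.
  by rewrite subr_eq0 => /eqP XS; case: nS; rewrite -XS.
have line : is_line (<[S]> + <[X]>)%VS.
  split; first exact/dim_line2/free2P.
  by move=> A /mem_lineP[x [y ->]]; rewrite /symm linearD !linearZ /= sS sX.
have SW : S \in (<[S]> + <[X]>)%VS.
  by apply/mem_lineP; exists 1, 0; rewrite scale1r scale0r addr0.
have XW : X \in (<[S]> + <[X]>)%VS.
  by apply/mem_lineP; exists 0, 1; rewrite scale1r scale0r add0r.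
split=> // p H u v fuv uvW; apply: H => //; rewrite uvW; split=> //.
exists X, (X - S); split=> //; last by rewrite rpredB.
apply/free2P => x y; rewrite scalerBr addrA -scalerDl addrC -scaleNr.
case/indep => /eqP; rewrite oppr_eq0 => /eqP ->.
by rewrite addr0.
Qed.

End Lines.

(** * The lines of J through a generic matrix *)

Theorem theorem2p11 (n : nat) (L : {vspace 'M[CC]_n})
    (L_sym : forall K, K \in L -> symm K)
    (L_reg : exists2 K, K \in L & K \in unitmx)
    (L_codim : (\dim L + 2 <= (n * n.+1) %/ 2)%N) :
  exists d : nat,
    ML_degree L d /\
    generic (fun S => has_card (fun W => Jvar L W /\ lines_through S W) d).
Proof.
(* Regularity supplies a pairing [k0]; it is nonzero at generic [S], which therefore lies off the
   polar space. *)
have m_gt0 : (0 < \dim L)%N.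
  have n_gt0 : (0 < n)%N.
    have two := leq_trans (leq_addl _ _) L_codim.
    by rewrite lt0n; apply: contraTneq two => ->.
  case: L_reg => K KL Ku; rewrite lt0n dimv_eq0; apply/eqP => L0.
  have K0 : K = 0 by apply/eqP; rewrite -memv0 -L0.
  have := mulmxV Ku; rewrite K0 mul0mx => /matrixP/(_ (Ordinal n_gt0) (Ordinal n_gt0)).
  by rewrite !mxE eqxx => /esym/eqP; rewrite oner_eq0.
pose k0 := Ordinal m_gt0.
have /fin_all_exists[P HP] : forall c : 'I_n * 'I_n, exists P : {poly {mpoly CC[\dim L]}},
    P != 0 /\ forall X, recip L X -> (map_poly (meval (pairing L X)) P).[X c.1 c.2] = 0.
  by move=> c; have [P P0 PE] := recip_entry_relation L c.1 c.2; exists P.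
pose Pab a b := P (a, b).
have P0 a b : Pab a b != 0 by apply: (HP (a, b)).1.
have PE a b X : recip L X -> (map_poly (meval (pairing L X)) (Pab a b)).[X a b] = 0.
  exact: (HP (a, b)).2.
have [q q0 qE] := recip_det_relation L.
have [G1 [G2 [pol1 pol2 freeG]]] := polar_two L_codim.
have [d gd] := generic_fiber_card L_sym P0 PE q0 qE.
exists d; split; first exact: gd.
have gk : generic (fun S => pairing L S k0 != 0).
  have [S sS pS] := @pairing_surj n L L_sym (fun=> 1).
  apply: (@generic_polyfun n _ (fun S => pairing L S k0)) => //.
    exact: mxpolyfun_pairing.
  by exists S => //; rewrite pS oner_neq0.
have G10 : G1 != 0.
  apply/eqP => G0; have [|/eqP] := freeG 1 0; last by rewrite oner_eq0.
  by rewrite G0 scaler0 scale0r addr0.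
have gn := generic_not_recip L_sym P0 PE pol1 G10.
have gs := generic_not_on_secant L_sym P0 PE q0 qE k0 pol1 pol2 freeG.
have gp := generic_proper_at L_sym P0.
apply: generic_sub (generic_and (generic_and gd gs) (generic_and gk (generic_and gn gp))).
move=> S sS [[[s [us ss sP]] nsec] [kS [nS pS]]].
exists [seq (<[S]> + <[X]>)%VS | X <- s]; split; last 1 first.
- move=> W; split.
    move=> [JW [_ SW]].
    have [X fX <-] := Jvar_fiber P0 PE sS pS kS nS JW SW.
    by apply/mapP; exists X => //; apply/sP.
  case/mapP => X /sP fX ->.
  have JX := fiber_Jvar L_sym sS kS nS fX; split=> //; split; first by case: JX.
  by apply/mem_lineP; exists 1, 0; rewrite scale1r scale0r addr0.
- rewrite map_inj_in_uniq // => X X' /sP fX /sP fX' E.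
  apply: NNPP => /eqP ne; apply: nsec.
  (* Comparing the equal, nonzero pairings with [k0] makes [X'] an affine combination of [S] and
     [X]; solving for [S] places it on the secant through [X] and [X']. *)
  have /mem_lineP[x [y XE]] : X' \in (<[S]> + <[X]>)%VS.
    by rewrite E; apply/mem_lineP; exists 0, 1; rewrite scale1r scale0r add0r.
  have [_ pX] := (fiberP L_sym X sS).1 fX; have [_ pX'] := (fiberP L_sym X' sS).1 fX'.
  have xy : x = 1 - y.
    apply: (mulIf kS); have := pX' k0; rewrite XE pairingD !pairingZ pX mulrBl mul1r => {2}<-.
    by rewrite addrK.
  have y1 : y - 1 != 0.
    rewrite subr_eq0; apply: contraNneq ne => y1.
    by rewrite XE xy y1 subrr scale0r add0r scale1r.
  exists X, X', (y - 1)^-1; split=> //.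
  apply: (scalerI y1); rewrite scalerDr scalerA mulfV // scale1r XE xy.
  by apply/matrixP => i j; rewrite !mxE; ring.
by rewrite size_map.
Qed.
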